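(* Let $\gamma > -1$ be real and let $k \geq 0$ be an integer such that $\lambda := \gamma + \tfrac12 + k \geq 0$. Let $\mu_{\gamma,\gamma}$ be the probability measure $$\mu_{\gamma,\gamma}(dx) = \frac{\Gamma(\gamma+3/2)}{\sqrt{\pi}\,\Gamma(\gamma+1)}\,(1-x^2)^{\gamma}\,\mathbf{1}_{[-1,1]}(x)\,dx .$$ Then for all $z \in \mathbb{C}\setminus(-\infty,1]$, $$G_{\lambda,\mu_{\gamma,\gamma}}(z) = \frac{4^k\,[G_{\mathrm W}(z)]^{\lambda}}{\left[4-[G_{\mathrm W}(z)]^2\right]^{k}}\; {}_2F_1\!\left(k,\,1-k,\,\gamma+\tfrac32;\ \frac{[G_{\mathrm W}(z)]^2}{[G_{\mathrm W}(z)]^2-4}\right).$$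
   Context: For $\lambda \ge 0$ and a probability measure $\mu$ on $[-1,1]$, the generalized Stieltjes transform is $G_{\lambda,\mu}(z) := \int \frac{1}{(z-x)^{\lambda}}\,\mu(dx)$ for $z\in\mathbb{C}\setminus(-\infty,1]$, with the principal branch of the power. $G_{\mathrm W}$ is the Stieltjes transform of the Wigner distribution: $G_{\mathrm W}(z) = \int_{-1}^1 \frac{1}{z-x}\,\frac{2\sqrt{1-x^2}}{\pi}\,dx = \frac{2}{z+\sqrt{z^2-1}}$, where $\sqrt{z^2-1}$ is the branch analytic on $\mathbb{C}\setminus[-1,1]$ that is positive for $z>1$. $[G_{\mathrm W}(z)]^\lambda$ is the principal power. ${}_2F_1(a,b,c;u) = \sum_{n\ge0}\frac{(a)_n(b)_n}{(c)_n}\frac{u^n}{n!}$ is the Gauss hypergeometric function, with $(a)_n = a(a+1)\cdots(a+n-1)$, $(a)_0=1$; here the series terminates. *)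

(* Defs.v *)
From HB Require Import structures.
From mathcomp Require Import all_boot all_order all_algebra.
From mathcomp Require Import complex.
From mathcomp Require Import all_classical all_reals all_analysis measurable_realfun.
Import Order.TTheory GRing.Theory Num.Theory.
Import numFieldNormedType.Exports.

Set Implicit Arguments.
Unset Strict Implicit.
Unset Printing Implicit Defensive.

Local Open Scope classical_set_scope.
Local Open Scope ring_scope.
Local Open Scope complex_scope.

Section complex_power.
Context {R : realType}.
Implicit Types (z : R[i]) (lambda : R).

(* Principal argument, with values in ]-pi, pi] for z != 0. *)
Definition Carg z : R :=
  let t := acos (complex.Re z / complex.Re `|z|) in
  if 0 <= complex.Im z then t else - t.

Definition Clog z : R[i] := ln (complex.Re `|z|) +i* Carg z.

Definition Cexp z : R[i] :=
  (expR (complex.Re z) * cos (complex.Im z))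
    +i* (expR (complex.Re z) * sin (complex.Im z)).

(* Meaningful for z != 0 only. *)
Definition Cpow z lambda : R[i] := Cexp (lambda%:C * Clog z).

End complex_power.

Section gamma_function.
Context {R : realType}.

Definition Gamma (s : R) : R :=
  \int[lebesgue_measure]_(t in `]0%R, +oo[) (t `^ (s - 1) * expR (- t)).

Lemma Gamma_ge0 s : 0 <= Gamma s.
Proof.
apply: Rintegral_ge0 => t _.
by rewrite mulr_ge0 ?powR_ge0 ?expR_ge0.
Qed.

End gamma_function.

Section hypergeometric.
Context {R : realType}.

Definition pochhammer (a : R[i]) (n : nat) : R[i] :=
  \prod_(0 <= i < n) (a + i%:R).

Definition hyp2F1 (a b c u : R[i]) : R[i] :=
  limn (series (fun n => pochhammer a n * pochhammer b n / pochhammer c n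
                         * (u ^+ n / n`!%:R) : (R[i])^o)).

End hypergeometric.

Section density.
Context {R : realType}.
Implicit Types f : measurableTypeR R -> R.

Definition with_density f : set (measurableTypeR R) -> \bar R :=
  fun A => (\int[lebesgue_measure]_(x in A) (f x)%:E)%E.

Lemma with_density0 f : with_density f set0 = 0%E.
Proof. by rewrite /with_density integral_set0. Qed.

Lemma with_density_ge0 f A : (forall x, 0 <= f x) -> (0 <= with_density f A)%E.
Proof. move=> f0; apply: integral_ge0 => x _; rewrite lee_fin; exact: f0. Qed.

Lemma with_density_sigma_additive f :
  measurable_fun setT f -> (forall x, 0 <= f x) ->
  semi_sigma_additive (with_density f).
Proof.
move=> mf f0; apply: semi_sigma_additive_nng_induced.
- exact/measurable_EFinP.
- by move=> x; rewrite lee_fin.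
Qed.

End density.

Section ultraspherical.
Context {R : realType}.
Variable gamma : R.

(* For gamma < 0 powR gives the value 0 at x = -1 and x = 1, a null set. *)
Definition ultraspherical_pdf (x : measurableTypeR R) : R :=
  Gamma (gamma + 3 / 2) / (Num.sqrt pi * Gamma (gamma + 1))
  * (1 - x ^+ 2) `^ gamma * \1_(`[-1, 1] : set R) x.

Lemma ultraspherical_pdf_ge0 x : 0 <= ultraspherical_pdf x.
Proof.
by rewrite /ultraspherical_pdf
  !(mulr_ge0, invr_ge0, powR_ge0, Gamma_ge0, sqrtr_ge0).
Qed.

Lemma measurable_ultraspherical_pdf : measurable_fun setT ultraspherical_pdf.
Proof.
apply: measurable_funM; last exact: measurable_indic.
apply: measurable_funM => //.
apply: measurableT_comp (measurable_powR _) _.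
by apply: measurable_funB => //; exact: measurable_funX.
Qed.

Definition ultraspherical := with_density ultraspherical_pdf.

(* Total mass 1 needs -1 < gamma; the measure structure does not, so that the
   instance takes no hypothesis on gamma. *)
HB.instance Definition _ := isMeasure.Build _ _ _ ultraspherical
  (with_density0 ultraspherical_pdf)
  (fun A => with_density_ge0 A ultraspherical_pdf_ge0)
  (with_density_sigma_additive measurable_ultraspherical_pdf
     ultraspherical_pdf_ge0).

End ultraspherical.

Section wigner.
Context {R : realType}.

Definition wigner_pdf (x : measurableTypeR R) : R :=
  2 * Num.sqrt (1 - x ^+ 2) / pi * \1_(`[-1, 1] : set R) x.

Lemma wigner_pdf_ge0 x : 0 <= wigner_pdf x.
Proof.
by rewrite /wigner_pdf !mulr_ge0 ?invr_ge0 ?pi_ge0 ?sqrtr_ge0.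
Qed.

Lemma measurable_wigner_pdf : measurable_fun setT wigner_pdf.
Proof.
apply: measurable_funM; last exact: measurable_indic.
apply: measurable_funM => //.
apply: measurable_funM => //.
apply: measurableT_comp (@continuous_measurable_fun R _ (@sqrt_continuous R)) _.
by apply: measurable_funB => //; exact: measurable_funX.
Qed.

Definition wigner := with_density wigner_pdf.

HB.instance Definition _ := isMeasure.Build _ _ _ wigner
  (with_density0 wigner_pdf)
  (fun A => with_density_ge0 A wigner_pdf_ge0)
  (with_density_sigma_additive measurable_wigner_pdf wigner_pdf_ge0).

End wigner.

Section stieltjes.
Context {R : realType}.
Implicit Types mu : {measure set (measurableTypeR R) -> \bar R}.

Definition Cintegral mu (f : R -> R[i]) : R[i] :=
  (\int[mu]_x complex.Re (f x)) +i* (\int[mu]_x complex.Im (f x)).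

(* The measure need not be normalized; it is meant to be carried by [-1, 1],
   and z to lie off ]-oo, 1]. *)
Definition gen_stieltjes (lambda : R) mu (z : R[i]) : R[i] :=
  Cintegral mu (fun x => (Cpow (z - x%:C) lambda)^-1).

Definition stieltjes mu (z : R[i]) : R[i] :=
  Cintegral mu (fun x => (z - x%:C)^-1).

Definition G_W (z : R[i]) : R[i] := stieltjes wigner z.

End stieltjes.

(* Main.v *)
Require Import Defs.
From HB Require Import structures.
From mathcomp Require Import all_boot all_order all_algebra.
From mathcomp Require Import complex ring lra.
From mathcomp Require Import all_classical all_reals all_analysis measurable_realfun.
Import Order.TTheory GRing.Theory Num.Theory.
Import numFieldNormedType.Exports.

(** Write [G] for [G_W z], [l] for [gamma + 1/2], and [Phi_p] for the integral of
[(z - x)^(-p)] against the measure, so that the left-hand side is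
[Phi_(l+k)]. The proof is an induction on [k] by a three-term recurrence; the
point [z] is moved to infinity along the half-line [z + s], [0 <= s], which
avoids the cut, and everything is reduced to identities checked by
differentiating along this half-line and taking the limit at its end.

Two facts hold for every weight [K (1 - x^2)^g] of mass 1 on [-1, 1].
Differentiation under the integral gives [Phi_p' = - p Phi_(p+1)]
([is_cderive_CintI_skernel]). Integrating the derivative of
[(1 - x^2)^(g+1) (z - x)^(-p-1)], which is 0 since [g > -1], gives a relation
between [Phi_p], [Phi_(p+1)] and [Phi_(p+2)] ([contiguous_skernel]).

For [g = 1/2] these two facts yield a first order linear differential equation
for [G]. It implies that [G^2 - 4 z G + 4] is a constant multiple of [z^2 - 1];
as the former is bounded at infinity and the latter is not, the constant is 0
([G_W_quadratic]).
Thus [z = 1 / G + G / 4], and [S = 1 / G - G / 4] is a square root of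
[z^2 - 1], with [G' = - G / S] and [S' = z / S]. In terms of [S], the rational
factor of the theorem is [4^k G^k / (4 - G^2)^k = S^(-k)], and the argument [v]
of the hypergeometric function satisfies [1 - 2 v = z / S].

The orders [l] and [l + 1] come first. The function
[G^l (S Phi_(l+1) - Phi_l)] has zero derivative by the contiguous relation at
order [l], and it is [O(|G|^(2 l + 1))], which tends to 0 because
[2 l + 1 = 2 (gamma + 1)] is positive. So [S Phi_(l+1) = Phi_l] ([Phi_succ]).
The logarithmic derivatives of [Phi_l] and of [G^l] then coincide, and the
quotient of these functions tends to 1, so that [Phi_l = G^l] ([Phi_base]).
These are the cases [k = 0] and [k = 1], in which the hypergeometric factor
is 1.

Finally, the contiguous relation at order [l + n] shows that
[P_n = S^n Phi_(l+n)] satisfies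
[(c + n) P_(n+2) = (2 n + 1) (1 - 2 v) P_(n+1) + (c - n - 1) P_n],
where [c = gamma + 3/2] ([Psi_rec]). The terminating series
[2F1 (n, 1 - n; c; v)] satisfy the same recurrence, coefficient by coefficient
([hyp_term_rec], [hyp_rec]), and so [P_n = G^l 2F1 (n, 1 - n; c; v)] for all [n]
([Psi_hyp]), which is the theorem.

The limit 1 above uses that the measure has mass 1. Its normalizing constant is
obtained by integrating a function of two variables in both orders, which
evaluates the Beta integral in terms of the Gamma function and the Gauss
integral ([beta_gamma_gauss]). *)

Set Implicit Arguments.
Unset Strict Implicit.
Unset Printing Implicit Defensive.

Local Open Scope classical_set_scope.
Local Open Scope ring_scope.
Local Open Scope complex_scope.

(** * The modulus as a real number *)

Section modulus.
Context {R : realType}.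
Implicit Types z w : R[i].

(** The norm of [R[i]] takes its values in [R[i]]; this is the same number
read in [R]. *)
Definition cabs z : R := complex.Re `|z|.

Lemma normc_cabs z : `|z| = (cabs z)%:C.
Proof. by rewrite /cabs normc_def. Qed.

Lemma cabsE z : cabs z = Num.sqrt (complex.Re z ^+ 2 + complex.Im z ^+ 2).
Proof. by rewrite /cabs normc_def. Qed.

Lemma cabs_ge0 z : 0 <= cabs z.
Proof. by rewrite cabsE sqrtr_ge0. Qed.

Lemma cabs_eq0 z : (cabs z == 0) = (z == 0).
Proof. by rewrite -(normr_eq0 z) normc_cabs eq_complex /= eqxx andbT. Qed.

Lemma cabs_gt0 z : (0 < cabs z) = (z != 0).
Proof. by rewrite lt_def cabs_eq0 cabs_ge0 andbT. Qed.

Lemma cabs_sqr z : cabs z ^+ 2 = complex.Re z ^+ 2 + complex.Im z ^+ 2.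
Proof. by rewrite cabsE sqr_sqrtr// addr_ge0// sqr_ge0. Qed.

Lemma cabsM z w : cabs (z * w) = cabs z * cabs w.
Proof. by apply: complexI; rewrite -normc_cabs normrM !normc_cabs rmorphM. Qed.

Lemma cabsD z w : cabs (z + w) <= cabs z + cabs w.
Proof. by rewrite -lecR -normc_cabs rmorphD /= -!normc_cabs ler_normD. Qed.

Lemma cabsN z : cabs (- z) = cabs z.
Proof. by rewrite /cabs normrN. Qed.

Lemma cabsV z : cabs z^-1 = (cabs z)^-1.
Proof. by apply: complexI; rewrite -normc_cabs normfV !normc_cabs fmorphV. Qed.

Lemma cabs_real (x : R) : cabs x%:C = `|x|.
Proof. by rewrite cabsE /= expr0n /= addr0 sqrtr_sqr. Qed.

Lemma cabs_nat n : cabs (n%:R : R[i]) = n%:R.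
Proof. by rewrite -(rmorph_nat (real_complex R)) cabs_real ger0_norm. Qed.

Lemma Re_le_cabs z : `|complex.Re z| <= cabs z.
Proof. by rewrite cabsE -sqrtr_sqr ler_wsqrtr// lerDl sqr_ge0. Qed.

Lemma Im_le_cabs z : `|complex.Im z| <= cabs z.
Proof. by rewrite cabsE -sqrtr_sqr ler_wsqrtr// lerDr sqr_ge0. Qed.

Lemma cabs_le_ReIm z : cabs z <= `|complex.Re z| + `|complex.Im z|.
Proof.
rewrite cabsE -[leRHS]ger0_norm ?addr_ge0// -sqrtr_sqr ler_wsqrtr//.
rewrite sqrrD !real_normK ?num_real// lerD2r lerDl.
by rewrite mulrn_wge0// mulr_ge0.
Qed.

Lemma cReM z w : complex.Re (z * w) =
  complex.Re z * complex.Re w - complex.Im z * complex.Im w.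
Proof. by case: z w => a b [c d]. Qed.

Lemma cImM z w : complex.Im (z * w) =
  complex.Re z * complex.Im w + complex.Im z * complex.Re w.
Proof. by case: z w => a b [c d]. Qed.

Lemma cReD z w : complex.Re (z + w) = complex.Re z + complex.Re w.
Proof. by case: z w => a b [c d]. Qed.

Lemma cImD z w : complex.Im (z + w) = complex.Im z + complex.Im w.
Proof. by case: z w => a b [c d]. Qed.

Lemma cReN z : complex.Re (- z) = - complex.Re z.
Proof. by case: z. Qed.

Lemma cImN z : complex.Im (- z) = - complex.Im z.
Proof. by case: z. Qed.

Lemma cReV z : complex.Re z^-1 =
  complex.Re z / (complex.Re z ^+ 2 + complex.Im z ^+ 2).
Proof. by case: z. Qed.

Lemma cImV z : complex.Im z^-1 =
  - (complex.Im z / (complex.Re z ^+ 2 + complex.Im z ^+ 2)).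
Proof. by case: z. Qed.

Lemma complex_ext z w :
  complex.Re z = complex.Re w -> complex.Im z = complex.Im w -> z = w.
Proof. by case: z w => a b [c d] /= -> ->. Qed.

Lemma sqReIm_neq0 z : z != 0 -> complex.Re z ^+ 2 + complex.Im z ^+ 2 != 0.
Proof. by rewrite -cabs_sqr expf_eq0 /= cabs_eq0. Qed.

End modulus.

(** * The slit plane and the principal power *)

Section slit_plane.
Context {R : realType}.
Implicit Types (z w : R[i]) (p q : R).

(** The complement of the half-line ]-oo, 0], on which the principal logarithm
is smooth. *)
Definition slit z : bool := (complex.Im z != 0) || (0 < complex.Re z).

Lemma slit_neq0 z : slit z -> z != 0.
Proof.
by apply: contraTneq => ->; rewrite /slit /= eqxx ltxx.
Qed.

(** [Carg] is defined by an arc cosine, which is not differentiable at the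
points 1 and -1 met on the real axis. This formula and the next one express it
by arctangents on two open sets that cover the slit plane. *)
Lemma Carg_Re_gt0 z : 0 < complex.Re z ->
  Carg z = atan (complex.Im z / complex.Re z).
Proof.
rewrite /Carg -/(cabs z) => a0.
set a := complex.Re z in a0 *; set b := complex.Im z.
have cosE : cos (atan (b / a)) = a / cabs z.
  rewrite cos_atan cabsE -/a -/b.
  have -> : a ^+ 2 + b ^+ 2 = a ^+ 2 * (1 + (b / a) ^+ 2).
    by field; rewrite gt_eqF.
  rewrite sqrtrM ?sqr_ge0// sqrtr_sqr gtr0_norm//.
  have : 0 < Num.sqrt (1 + (b / a) ^+ 2).
    by rewrite sqrtr_gt0 ltr_pwDl// sqr_ge0.
  by move: (Num.sqrt _) => s s0; field; rewrite !gt_eqF.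
rewrite -cosE; have := pi_gt0 R; have := atan_gtNpi2 (b / a).
have := atan_ltpi2 (b / a) => /= h1 h2 h3.
case: ifPn => [b0|]; last rewrite -ltNge => b0.
  have t0 : 0 <= atan (b / a).
    by rewrite -(@atan0 R) le_atan// divr_ge0// ltW.
  by rewrite cosK// in_itv /= t0 /= (le_trans (ltW h1))// ler_pdivrMr//; lra.
have t0 : atan (b / a) <= 0.
  by rewrite -(@atan0 R) le_atan// pmulr_lle0 ?invr_gt0// ltW.
by rewrite cosKN ?opprK// t0 andbT; lra.
Qed.

Lemma Carg_Im_neq0 z : complex.Im z != 0 ->
  Carg z = Num.sg (complex.Im z) * (pi / 2) - atan (complex.Re z / complex.Im z).
Proof.
rewrite /Carg -/(cabs z) => b0.
set a := complex.Re z; set b := complex.Im z in b0 *.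
set t := atan _.
have : 0 < Num.sqrt (1 + (a / b) ^+ 2).
  by rewrite sqrtr_gt0 ltr_pwDl// sqr_ge0.
have sinE : sin t = a / b / Num.sqrt (1 + (a / b) ^+ 2).
  have := cos_atan (a / b); rewrite -/t => ct.
  have := atanK (a / b); rewrite -/t /tan => /(canRL (mulfVK _)) ->.
    by rewrite ct.
  rewrite ct invr_neq0// sqrtr_eq0 -ltNge ltr_pwDl// sqr_ge0//.
have cabsE' : cabs z = `|b| * Num.sqrt (1 + (a / b) ^+ 2).
  rewrite cabsE -/a -/b.
  have -> : a ^+ 2 + b ^+ 2 = b ^+ 2 * (1 + (a / b) ^+ 2) by field.
  by rewrite sqrtrM ?sqr_ge0// sqrtr_sqr.
have := atan_gtNpi2 (a / b); have := atan_ltpi2 (a / b).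
rewrite -/t cabsE' => h1 h2; move: sinE; move: (Num.sqrt _) => s sinE s0.
have [b1|b1|] := ltgtP 0 b; last by move=> b1; rewrite -b1 eqxx in b0.
- rewrite gtr0_sg// mul1r gtr0_norm//.
  have -> : a / (b * s) = cos (pi / 2 - t).
    rewrite cosB cos_pihalf sin_pihalf sinE; field.
    by rewrite !gt_eqF.
  by rewrite cosK// in_itv /=; lra.
- rewrite ltr0_sg// ltr0_norm//.
  have -> : a / (- b * s) = cos (pi / 2 + t).
    rewrite cosD cos_pihalf sin_pihalf sinE; field.
    by rewrite (gt_eqF s0) (lt_eqF b1).
  by rewrite cosK; first (rewrite mulN1r opprD; lra); rewrite in_itv /=; lra.
Qed.

Lemma CexpD z w : Cexp (z + w) = Cexp z * Cexp w.
Proof.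
rewrite /Cexp; apply: complex_ext; rewrite /= !cReD !cImD expRD ?cosD ?sinD; ring.
Qed.

Lemma Cexp0 : Cexp 0 = 1 :> R[i].
Proof. by rewrite /Cexp /= expR0 cos0 sin0 mul1r mulr0. Qed.

Lemma cabs_Cexp z : cabs (Cexp z) = expR (complex.Re z).
Proof.
apply/eqP; rewrite -(@eqrXn2 _ 2)// ?cabs_ge0 ?expR_ge0//.
rewrite cabs_sqr /= !exprMn -mulrDr cos2Dsin2 mulr1//.
Qed.

Lemma Cexp_neq0 z : Cexp z != 0.
Proof. by rewrite -cabs_gt0 cabs_Cexp expR_gt0. Qed.

Lemma CexpN z : Cexp (- z) = (Cexp z)^-1.
Proof.
apply: (mulIf (Cexp_neq0 z)); rewrite -CexpD addNr Cexp0 mulVf// Cexp_neq0 //.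
Qed.

Lemma Clog_slitK z : slit z -> Cexp (Clog z) = z.
Proof.
move=> sz; have z0 := slit_neq0 sz; rewrite /Clog /Cexp /= -/(cabs z).
rewrite lnK ?posrE ?cabs_gt0//.
set r := complex.Re z / cabs z.
have r2 : 1 - r ^+ 2 = (complex.Im z / cabs z) ^+ 2.
  rewrite -[1](@divff _ (cabs z ^+ 2)) ?expf_neq0 ?cabs_eq0//.
  rewrite {1}cabs_sqr /r; field; by rewrite cabs_eq0.
have r1 : -1 <= r <= 1.
  rewrite -ler_norml; rewrite -(@expr_le1 _ 2)// real_normK ?num_real//.
  by rewrite -subr_ge0 r2 sqr_ge0.
have h1 : cos (Carg z) = r.
  rewrite /Carg -/(cabs z) -/r; case: ifP => _; rewrite ?cosN acosK//.
have h2 : sin (Carg z) = complex.Im z / cabs z.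
  rewrite /Carg -/(cabs z) -/r; case: ifPn => [b0|].
    rewrite sin_acos// r2 sqrtr_sqr ger0_norm// divr_ge0// cabs_ge0 //.
  rewrite -ltNge => b0; rewrite sinN sin_acos// r2 sqrtr_sqr ler0_norm ?opprK//.
  by rewrite pmulr_lle0 ?invr_gt0 ?cabs_gt0// ltW.
have c0 : cabs z != 0 by rewrite cabs_eq0.
apply: complex_ext => /=; rewrite ?h1 ?h2 /r [LHS]mulrC divfK //.
Qed.

Lemma CpowD z p q : Cpow z (p + q) = Cpow z p * Cpow z q.
Proof. by rewrite /Cpow rmorphD /= mulrDl CexpD. Qed.

Lemma Cpow0 z : Cpow z 0 = 1.
Proof. by rewrite /Cpow mul0r Cexp0. Qed.

Lemma CpowN z p : Cpow z (- p) = (Cpow z p)^-1.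
Proof. by rewrite /Cpow rmorphN /= mulNr CexpN. Qed.

Lemma Cpow1 z : slit z -> Cpow z 1 = z.
Proof. by move=> sz; rewrite /Cpow mul1r Clog_slitK. Qed.

Lemma CpowDn z p n : slit z -> Cpow z (p + n%:R) = Cpow z p * z ^+ n.
Proof.
move=> sz; elim: n => [|n IH]; first by rewrite addr0 expr0 mulr1.
by rewrite -natr1 addrA CpowD IH Cpow1// exprSr mulrA.
Qed.

Lemma Cpow_neq0 z p : Cpow z p != 0.
Proof. exact: Cexp_neq0. Qed.

Lemma cabs_Cpow z p : z != 0 -> cabs (Cpow z p) = cabs z `^ p.
Proof.
move=> z0; rewrite /Cpow cabs_Cexp cReM /= mul0r subr0 -/(cabs z) /powR.
by rewrite cabs_eq0 (negbTE z0).
Qed.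

End slit_plane.

(** * Derivatives along paths *)

Section real_derivative.
Context {R : realType}.
Implicit Types (f g : R -> R) (x a b : R).

Lemma is_derive1V g x b : is_derive x 1 g b -> g x != 0 ->
  is_derive x 1 (fun s => (g s)^-1) (- b / g x ^+ 2).
Proof.
move=> gb g0; apply: (is_derive_eq (is_deriveV g0 gb)).
by rewrite -![_ *: _]/(_ * _); field.
Qed.

Lemma is_derive1_compose f g x a b : is_derive x 1 g b ->
  is_derive (g x) 1 f a -> is_derive x 1 (fun s => f (g s)) (a * b).
Proof. by move=> gb fa; exact: is_derive1_comp. Qed.

End real_derivative.

Section path_derivative.
Context {R : realType}.
Implicit Types (f g : R -> R[i]) (t : R) (d e : R[i]).

(** Derivative with respect to a real parameter, coordinate by coordinate: all
differential equations below are used along a half-line [z + s], [0 <= s]. *)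
Definition is_cderive t f d :=
  is_derive t (1 : R) (fun s => complex.Re (f s)) (complex.Re d) /\
  is_derive t (1 : R) (fun s => complex.Im (f s)) (complex.Im d).

Lemma is_cderive_eq t f d e : is_cderive t f d -> d = e -> is_cderive t f e.
Proof. by move=> fd <-. Qed.

Lemma near_is_cderive t f g d : (\near t, f t = g t) ->
  is_cderive t f d -> is_cderive t g d.
Proof.
move=> fg [f1 f2]; split.
- apply: (near_eq_is_derive (f := fun s => complex.Re (f s))).
  by near=> s; rewrite (near fg s).
- apply: (near_eq_is_derive (f := fun s => complex.Im (f s))).
  by near=> s; rewrite (near fg s).
Unshelve. all: by end_near. Qed.

Lemma is_cderive_cst t d : is_cderive t (fun=> d) 0.
Proof. by split; apply: is_derive_cst. Qed.

Lemma is_cderive_real t (f : R -> R) (d : R) :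
  is_derive t 1 f d -> is_cderive t (fun s => (f s)%:C) d%:C.
Proof. by move=> fd; split => //=; apply: is_derive_cst. Qed.

Lemma is_cderiveD t f g d e : is_cderive t f d -> is_cderive t g e ->
  is_cderive t (fun s => f s + g s) (d + e).
Proof.
move=> [f1 f2] [g1 g2]; split.
- under eq_fun do rewrite cReD.
  by rewrite cReD; apply: is_derive_eq.
- under eq_fun do rewrite cImD.
  by rewrite cImD; apply: is_derive_eq.
Qed.

Lemma is_cderiveM t f g d e : is_cderive t f d -> is_cderive t g e ->
  is_cderive t (fun s => f s * g s) (d * g t + f t * e).
Proof.
move=> [f1 f2] [g1 g2]; split.
- under eq_fun do rewrite cReM.
  rewrite cReD !cReM; apply: is_derive_eq; rewrite -![_ *: _]/(_ * _); ring.
- under eq_fun do rewrite cImM.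
  rewrite cImD !cImM; apply: is_derive_eq; rewrite -![_ *: _]/(_ * _); ring.
Qed.

Lemma is_cderiveZ t f d e (fd : is_cderive t f d) :
  is_cderive t (fun s => e * f s) (e * d).
Proof.
apply: (is_cderive_eq (is_cderiveM (is_cderive_cst t e) fd)).
by rewrite mul0r add0r.
Qed.

Lemma is_cderiveN t f d : is_cderive t f d ->
  is_cderive t (fun s => - f s) (- d).
Proof.
move=> fd; have := is_cderiveZ (-1 : R[i]) fd.
by under eq_fun do rewrite mulN1r; rewrite mulN1r.
Qed.

Lemma is_cderiveB t f g d e : is_cderive t f d -> is_cderive t g e ->
  is_cderive t (fun s => f s - g s) (d - e).
Proof. by move=> fd ge; apply: is_cderiveD => //; exact: is_cderiveN. Qed.

Lemma is_cderiveV t f d : f t != 0 -> is_cderive t f d ->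
  is_cderive t (fun s => (f s)^-1) (- d / f t ^+ 2).
Proof.
move=> f0 [f1 f2]; have n0 := sqReIm_neq0 f0.
have dn : is_derive t (1 : R)
    (fun s => complex.Re (f s) ^+ 2 + complex.Im (f s) ^+ 2)
    (2 * complex.Re (f t) * complex.Re d + 2 * complex.Im (f t) * complex.Im d).
  by apply: is_derive_eq; rewrite -![_ *: _]/(_ * _); ring.
have dq := is_derive1V dn n0.
have nE : complex.Re (f t ^+ 2) ^+ 2 + complex.Im (f t ^+ 2) ^+ 2 =
    (complex.Re (f t) ^+ 2 + complex.Im (f t) ^+ 2) ^+ 2.
  by rewrite expr2 cReM cImM; ring.
have rE : complex.Re (f t ^+ 2) = complex.Re (f t) ^+ 2 - complex.Im (f t) ^+ 2.
  by rewrite expr2 cReM.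
have iE : complex.Im (f t ^+ 2) = 2 * complex.Re (f t) * complex.Im (f t).
  by rewrite expr2 cImM; ring.
move: (f t ^+ 2) nE rE iE => q nE rE iE.
split.
- under eq_fun do rewrite cReV.
  apply: is_derive_eq.
  rewrite -![_ *: _]/(_ * _) !(cReM,cImM,cReV,cImV,cReN,cImN) nE.
  by rewrite rE iE; field.
- under eq_fun do rewrite cImV.
  apply: is_derive_eq.
  rewrite -![_ *: _]/(_ * _) !(cReM,cImM,cReV,cImV,cReN,cImN) nE.
  by rewrite rE iE; field.
Qed.

Lemma is_cderive_Cexp t f d : is_cderive t f d ->
  is_cderive t (fun s => Cexp (f s)) (d * Cexp (f t)).
Proof.
move=> [f1 f2].
have d1 := is_derive1_compose f1 (is_derive_expR (complex.Re (f t))).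
have d2 := is_derive1_compose f2 (is_derive_cos (complex.Im (f t))).
have d3 := is_derive1_compose f2 (is_derive_sin (complex.Im (f t))).
split; rewrite ?cReM ?cImM /=.
- apply: (is_derive_eq (is_deriveM d1 d2)) => /=.
  by rewrite -![_ *: _]/(_ * _); ring.
- apply: (is_derive_eq (is_deriveM d1 d3)) => /=.
  by rewrite -![_ *: _]/(_ * _); ring.
Qed.

Lemma is_cderive_Clog t f d : slit (f t) -> is_cderive t f d ->
  is_cderive t (fun s => Clog (f s)) (d / f t).
Proof.
move=> sf [f1 f2]; have f0 := slit_neq0 sf; have n0 := sqReIm_neq0 f0.
have n0' : 0 < complex.Re (f t) ^+ 2 + complex.Im (f t) ^+ 2.
  by rewrite lt_def n0 addr_ge0// sqr_ge0.
have cf1 : {for t, continuous (fun s => complex.Re (f s))}.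
  by apply/differentiable_continuous/derivable1_diffP; exact: ex_derive.
have cf2 : {for t, continuous (fun s => complex.Im (f s))}.
  by apply/differentiable_continuous/derivable1_diffP; exact: ex_derive.
split => /=.
  rewrite (_ : (fun s => ln _) = fun s =>
      ln (Num.sqrt (complex.Re (f s) ^+ 2 + complex.Im (f s) ^+ 2))); last first.
    by apply/funext => s; congr ln; exact: cabsE.
  have s0 : 0 < Num.sqrt (complex.Re (f t) ^+ 2 + complex.Im (f t) ^+ 2).
    by rewrite sqrtr_gt0.
  have dn : is_derive t (1 : R)
    (fun s => complex.Re (f s) ^+ 2 + complex.Im (f s) ^+ 2)
    (2 * complex.Re (f t) * complex.Re d + 2 * complex.Im (f t) * complex.Im d).
    by apply: is_derive_eq; rewrite -![_ *: _]/(_ * _); ring.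
  have dsq := is_derive1_compose dn (is_derive1_sqrt n0').
  apply: (is_derive_eq (is_derive1_compose dsq (is_derive1_ln s0))).
  rewrite !(cReM,cImM,cReV,cImV).
  have := sqr_sqrtr (ltW n0').
  move: (Num.sqrt _) s0 => s s0 s2.
  rewrite -s2; field.
  by rewrite gt_eqF.
case: (boolP (0 < complex.Re (f t))) => [a0|a0].
  have a0' : complex.Re (f t) != 0 by rewrite gt_eqF.
  have dV := is_derive1V f1 a0'.
  have dM : is_derive t (1 : R)
    (fun s => complex.Im (f s) / complex.Re (f s)) _ := is_deriveM f2 dV.
  have da := is_derive1_compose dM (is_derive1_atan _).
  apply: (near_eq_is_derive (f := fun s => atan (complex.Im (f s) / complex.Re (f s)))).
    near=> s; rewrite Carg_Re_gt0//; near: s.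
    exact: (cvgr_gt _ cf1).
  apply: (is_derive_eq da).
  rewrite -![_ *: _]/(_ * _) !(cReM,cImM,cReV,cImV) /=.
  by field; apply/andP; split.
have b0 : complex.Im (f t) != 0.
  by move: sf; rewrite /slit (negbTE a0) orbF.
have dV := is_derive1V f2 b0.
have dM : is_derive t (1 : R)
    (fun s => complex.Re (f s) / complex.Im (f s)) _ := is_deriveM f1 dV.
have da := is_derive1_compose dM (is_derive1_atan _).
apply: (near_eq_is_derive (f := fun s => Num.sg (complex.Im (f t)) * (pi / 2)
   - atan (complex.Re (f s) / complex.Im (f s)))).
  (* The sign of the imaginary part is locally constant. *)
  near=> s; have sgE : Num.sg (complex.Im (f t)) = Num.sg (complex.Im (f s)).
    near: s; have [b1|b1|] := ltgtP 0 (complex.Im (f t)).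
    - near=> s; rewrite !gtr0_sg//; near: s; exact: (cvgr_gt _ cf2).
    - near=> s; rewrite !ltr0_sg//; near: s; exact: (cvgr_lt _ cf2).
    - by move=> b1; rewrite -b1 eqxx in b0.
  by rewrite sgE Carg_Im_neq0// -sgr_eq0 -sgE sgr_eq0.
apply: (is_derive_eq (is_deriveB (is_derive_cst _ _ _) da)).
rewrite -![_ *: _]/(_ * _) !(cReM,cImM,cReV,cImV) /=.
by field; apply/andP; split.
Unshelve. all: by end_near. Qed.

Lemma is_cderive_Cpow t f d p : slit (f t) -> is_cderive t f d ->
  is_cderive t (fun s => Cpow (f s) p) (p%:C * d / f t * Cpow (f t) p).
Proof.
move=> sf fd; apply: (is_cderive_eq (is_cderive_Cexp
  (is_cderiveZ p%:C (is_cderive_Clog sf fd)))).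
by rewrite mulrA.
Qed.

(** The mean value theorem on each coordinate. Together with a limit at
infinity, it turns the differential equations below into identities. *)
Lemma is_cderive0_cst f : (forall s : R, 0 <= s -> is_cderive s f 0) ->
  forall s : R, 0 <= s -> f s = f 0.
Proof.
move=> fd; suff H (g : R -> R) : (forall s : R, 0 <= s -> is_derive s 1 g 0) ->
    forall s : R, 0 <= s -> g s = g 0.
  move=> s s0; apply: complex_ext.
    by apply: (H (fun s => complex.Re (f s))) => // u u0; have [] := fd u u0.
  by apply: (H (fun s => complex.Im (f s))) => // u u0; have [] := fd u u0.
move=> gd s s0; apply/eqP; rewrite -subr_eq0; apply/eqP.
have [||c _ ->] := @MVT_segment R g (fun=> 0) 0 s s0; last by rewrite mul0r.
  by move=> x; rewrite in_itv /= => /andP[x0 _]; apply: gd; exact: ltW.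
apply: derivable_within_continuous => x; rewrite in_itv /= => /andP[x0 _].
by have := gd x x0 => ?; exact: ex_derive.
Qed.

End path_derivative.

(** * Integrals against a density *)

Section density_integral.
Context d (T : measurableType d) {R : realType}.
Variables nu mu : {measure set T -> \bar R}.
Variable f : T -> R.
Hypothesis mf : measurable_fun setT f.
Hypothesis f0 : forall x, 0 <= f x.
Hypothesis muE : forall A, measurable A ->
  mu A = (\int[nu]_(x in A) (f x)%:E)%E.

Import HBNNSimple.
Local Open Scope ereal_scope.

Let mfD (D : set T) : measurable_fun D (EFin \o f).
Proof. by apply/measurable_EFinP; exact: measurable_funTS. Qed.

Lemma integral_density_indic (D A : set T) : measurable D -> measurable A ->
  \int[mu]_(x in D) (\1_A x)%:E = \int[nu]_(x in D) ((\1_A x)%:E * (f x)%:E).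
Proof.
move=> mD mA; rewrite integral_indic// muE; last exact: measurableI.
rewrite setIC integral_mkcondr; apply: eq_integral => x _.
by rewrite epatch_indic muleC.
Qed.

Lemma integral_density_nnsfun (D : set T) (h : {nnsfun T >-> R}) :
  measurable D ->
  \int[mu]_(x in D) (h x)%:E = \int[nu]_(x in D) ((h x)%:E * (f x)%:E).
Proof.
move=> mD.
have hE x : (h x)%:E = \sum_(r \in range h) (r%:E * (\1_(h @^-1` [set r]) x)%:E).
  by rewrite {1}fimfunE -fsumEFin//; apply: eq_fsbigr => r _; rewrite EFinM.
have h_ge0 r x : 0 <= r%:E * (\1_(h @^-1` [set r]) x)%:E.
  by rewrite -EFinM; exact: nnfun_muleindic_ge0.
have mind r : measurable_fun D (fun x => (\1_(h @^-1` [set r]) x)%:E).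
  by apply/measurable_EFinP; exact: measurable_indic.
under eq_integral do rewrite hE.
under [RHS]eq_integral do rewrite hE ge0_mule_fsuml//.
rewrite !ge0_integral_fsum//; first last.
- by move=> r; exact: measurable_funeM.
- by move=> r x _; rewrite mule_ge0// lee_fin.
- by move=> r; apply: emeasurable_funM => //; exact: measurable_funeM.
apply: eq_fsbigr => r; rewrite inE => -[t _ <-].
under [RHS]eq_integral do rewrite -muleA.
rewrite !ge0_integralZl// ?lee_fin//.
- by rewrite integral_density_indic.
- exact: emeasurable_funM.
- by move=> x _; rewrite mule_ge0 ?lee_fin.
Qed.

(** For indicators the two sides agree by the definition of a density, hence
they agree for simple functions, and monotone convergence extends this to all
nonnegative functions. *)
Lemma ge0_integral_density (D : set T) (g : T -> \bar R) :
  measurable D -> measurable_fun D g -> (forall x, 0 <= g x) ->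
  \int[mu]_(x in D) g x = \int[nu]_(x in D) (g x * (f x)%:E).
Proof.
move=> mD mg g0; pose h := nnsfun_approx mD mg.
have h_g x : D x -> (h n x)%:E @[n --> \oo] --> g x.
  by move=> Dx; exact: cvg_nnsfun_approx.
have h_nd x m n : (m <= n)%N -> (h m x)%:E <= (h n x)%:E.
  by move=> mn; rewrite lee_fin; exact/lefP/nd_nnsfun_approx.
have mh n : measurable_fun D (EFin \o h n).
  by apply/measurable_EFinP; exact: measurable_funTS.
have cvg_mu : \int[mu]_(x in D) (h n x)%:E @[n --> \oo] --> \int[mu]_(x in D) g x.
  rewrite [X in _ --> X](_ : _ = \int[mu]_(x in D) limn (fun n => (h n x)%:E)).
    apply: cvg_monotone_convergence => //.
    - by move=> n x _; rewrite lee_fin.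
    - by move=> x _ m n; exact: h_nd.
  by apply: eq_integral => x; rewrite inE => /h_g/cvg_lim ->.
have cvg_nu : \int[nu]_(x in D) ((h n x)%:E * (f x)%:E) @[n --> \oo] -->
    \int[nu]_(x in D) (g x * (f x)%:E).
  rewrite [X in _ --> X](_ : _ =
      \int[nu]_(x in D) limn (fun n => (h n x)%:E * (f x)%:E)).
    apply: cvg_monotone_convergence => //.
    - by move=> n; exact: emeasurable_funM (mh n) (@mfD D).
    - by move=> n x _; rewrite mule_ge0 ?lee_fin.
    - by move=> x _ m n mn; rewrite lee_wpmul2r ?lee_fin// -lee_fin h_nd.
  apply: eq_integral => x; rewrite inE => /h_g hx.
  by apply/esym/cvg_lim => //; exact: cvgeZr.
move: cvg_mu; under eq_fun do rewrite integral_density_nnsfun//.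
by move=> cvg_mu; exact: (cvg_unique _ cvg_mu cvg_nu).
Qed.

Lemma integral_density (D : set T) (g : T -> R) :
  measurable D -> measurable_fun D g ->
  \int[mu]_(x in D) (g x)%:E = \int[nu]_(x in D) (g x * f x)%:E.
Proof.
move=> mD mg; have mg' : measurable_fun D (EFin \o g) by exact/measurable_EFinP.
rewrite integralE [RHS]integralE !ge0_integral_density//; last 2 first.
- exact: measurable_funeneg.
- exact: measurable_funepos.
congr (_ - _); apply: eq_integral => x _.
- by rewrite !funeposE -!EFin_max -EFinM maxr_pMl// mul0r.
- by rewrite !funenegE -!EFinN -!EFin_max -EFinM maxr_pMl// mul0r mulNr.
Qed.

Lemma Rintegral_density (D : set T) (g : T -> R) :
  measurable D -> measurable_fun D g ->
  (\int[mu]_(x in D) g x = \int[nu]_(x in D) (g x * f x))%R.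
Proof. by move=> mD mg; rewrite /Rintegral integral_density. Qed.

End density_integral.

(** * Affine changes of variable and the fundamental theorem *)

Section affine_change.
Context {R : realType}.
Notation leb := (@lebesgue_measure R).
Local Open Scope ereal_scope.

Lemma measurable_affine (a b : R) :
  measurable_fun [set: measurableTypeR R]
    ((fun x => (a * x + b)%R) : measurableTypeR R -> measurableTypeR R).
Proof. by apply: measurable_funD => //; exact: measurable_funM. Qed.

(** Both sides are measures of [A], and they agree on half-open intervals. *)
Lemma lebesgue_affine (a b : R) (A : set (measurableTypeR R)) : (0 < a)%R ->
  measurable A -> leb A = a%:E * leb ((fun x => (a * x + b)%R) @^-1` A).
Proof.
move=> a0.
pose nu : {measure set (measurableTypeR R) -> \bar R} :=
  measure_function_pushforward__canonical__measure_function_Measure leb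
    (measurable_affine a b).
pose k : {nonneg R} := NngNum (ltW a0).
move=> mA; apply: (lebesgue_measure_unique (mu := mscale k nu)) => // X.
move=> [[u v] _ <-].
have E : (fun x => (a * x + b)%R) @^-1` `]u, v] =
    `]((u - b) / a)%R, ((v - b) / a)%R]%classic.
  apply/seteqP; split => x /=; rewrite !in_itv /= ltr_pdivrMr// ler_pdivlMr//;
  by rewrite ltrBlDr lerBrDr mulrC.
rewrite /mscale [X in _ = _ * X](_ : _ =
    leb `]((u - b) / a)%R, ((v - b) / a)%R]%classic); last first.
  by rewrite -E.
rewrite !lebesgue_measure_itv /= !lte_fin ltr_pM2r ?invr_gt0// ltrD2r.
case: ifPn => uv; last by rewrite mule0.
rewrite -!EFinD -EFinM; congr EFin; field.
by rewrite gt_eqF.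
Qed.

Lemma ge0_integral_affine (a b : R) (f : measurableTypeR R -> \bar R) :
  (0 < a)%R -> measurable_fun setT f -> (forall x, 0 <= f x) ->
  \int[leb]_x f x = a%:E * \int[leb]_x f (a * x + b)%R.
Proof.
move=> a0 mf f0.
pose nu : {measure set (measurableTypeR R) -> \bar R} :=
  measure_function_pushforward__canonical__measure_function_Measure leb
    (measurable_affine a b).
pose k : {nonneg R} := NngNum (ltW a0).
rewrite (eq_measure_integral (mscale k nu)); last first.
  by move=> A mA _; exact: lebesgue_affine.
rewrite ge0_integral_mscale//; congr (_ * _).
rewrite ge0_integral_pushforward//; exact: measurable_affine.
Qed.

End affine_change.

Section ftc_closed.
Context {R : realType}.
Notation leb := (@lebesgue_measure R).

Lemma is_derive_continuous (f : R -> R) (x d : R) :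
  is_derive x 1 f d -> {for x, continuous f}.
Proof.
by move=> fd; apply/differentiable_continuous/derivable1_diffP; exact: ex_derive.
Qed.

Lemma FTC_closed (F f : R -> R) (a b : R) : a < b ->
  (forall x, a <= x <= b -> is_derive x 1 F (f x)) ->
  (forall x, a <= x <= b -> {for x, continuous f}) ->
  (\int[leb]_(x in `[a, b]) (f x)%:E = (F b - F a)%:E)%E.
Proof.
move=> ab dF cf; rewrite EFinB; apply: continuous_FTC2 => //.
- apply: continuous_in_subspaceT => x; rewrite inE /= in_itv /=; exact: cf.
- have cF x : a <= x <= b -> {for x, continuous F}.
    by move=> xab; apply: is_derive_continuous; exact: dF.
  split.
  + move=> x; rewrite in_itv /= => /andP[ax xb].
    by have := dF x; rewrite !ltW// => /(_ isT) h; exact: ex_derive.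
  + by apply: cvg_at_right_filter; apply: cF; rewrite lexx ltW.
  + by apply: cvg_at_left_filter; apply: cF; rewrite lexx ltW.
- move=> x; rewrite in_itv /= => /andP[ax xb].
  by have := dF x; rewrite !ltW// => /(_ isT) h; rewrite derive1E derive_val.
Qed.

End ftc_closed.

(** * Convergence of the Gamma integral *)

Section gamma_finite.
Context {R : realType}.
Notation leb := (@lebesgue_measure R).
Implicit Types (s t x y g : R).

Definition gamma_density g t : R :=
  t `^ g * expR (- t) * \1_(`]0, +oo[ : set R) t.

Lemma gamma_density_ge0 g t : 0 <= gamma_density g t.
Proof. by rewrite !mulr_ge0 ?powR_ge0 ?expR_ge0. Qed.

Lemma measurable_gamma_density g :
  measurable_fun [set: measurableTypeR R] (gamma_density g).
Proof.
apply: measurable_funM => //; apply: measurable_funM => //.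
  exact: measurableT_comp.
Qed.

(** From [1 + x <= exp x] at [x = (1 + t) / p], raised to the power [p]. The
bound is used with [p = g + 2], for which [t^g (1 + t)^(-p)] has an elementary
antiderivative. *)
Lemma expRN_le_powR p t : 0 < p -> 0 < t ->
  expR (- t) <= expR 1 * p `^ p * (1 + t) `^ (- p).
Proof.
move=> p0 t0; have t1 : 0 < 1 + t by lra.
rewrite powRN ler_pdivlMr ?powR_gt0//.
have H : (1 + t) `^ p <= p `^ p * expR (1 + t).
  have -> : expR (1 + t) = (expR ((1 + t) / p)) `^ p.
    by rewrite -expRM divfK// gt_eqF.
  rewrite -powRM ?expR_ge0//; last exact: ltW.
  have p0' := ltW p0; have t1' := ltW t1.
  apply: ge0_ler_powR; rewrite ?nnegrE ?mulr_ge0 ?expR_ge0//.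
  rewrite mulrC -ler_pdivrMr//.
  by have := expR_ge1Dx ((1 + t) / p); lra.
apply: le_trans (ler_wpM2l (expR_ge0 _) H) _.
by rewrite mulrCA -expRD addrCA addNr addr0 mulrC.
Qed.

(** With [s = g + 1], the integrand is at most [M t^g (1 + t)^(- s - 1)],
whose antiderivative [(M / s) (t / (1 + t))^s] stays between [0] and [M / s].
So the integrals over [[1 / (n + 1), n + 2]] are bounded, and these intervals
exhaust the half-line. *)
Lemma gamma_integral_lty g : -1 < g ->
  (\int[leb]_x (gamma_density g x)%:E < +oo)%E.
Proof.
move=> g1; pose s := g + 1; have s0 : 0 < s by rewrite /s; lra.
pose M := expR 1 * (s + 1) `^ (s + 1).
have M0 : 0 <= M by rewrite mulr_ge0 ?expR_ge0 ?powR_ge0.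
pose H t : R := (t / (1 + t)) `^ s.
pose h t : R := s * (t / (1 + t)) `^ g / (1 + t) ^+ 2.
have dH t : 0 < t -> is_derive t 1 H (h t).
  move=> t0; have t1 : 0 < 1 + t by lra.
  have d1 : is_derive t (1 : R) (fun x => 1 + x) 1.
    by apply: is_derive_eq; ring.
  have d2 := is_derive1V d1 (lt0r_neq0 t1).
  have d3 : is_derive t (1 : R) (fun x => x / (1 + x)) _ :=
    is_deriveM (is_derive_id _ _) d2.
  have q0 : 0 < t / (1 + t) by rewrite divr_gt0.
  apply: (is_derive_eq (is_derive1_compose d3 (is_derive1_powR s q0))).
  rewrite /h /s addrK -![_ *: _]/(_ * _); field.
  by rewrite gt_eqF.
have gh t : 0 < t -> gamma_density g t <= M / s * h t.
  move=> t0; have t1 : 0 < 1 + t by lra.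
  rewrite /gamma_density indicE mem_set /= ?in_itv/= ?t0// mulr1.
  have -> : M / s * h t = t `^ g * (M * (1 + t) `^ (- (s + 1))).
    have -> : (1 + t) `^ (- (s + 1)) = (1 + t) `^ (- g) / (1 + t) ^+ 2.
      rewrite -(powR_mulrn _ (ltW t1)) -powRN -powRD ?(gt_eqF t1) ?implybT//.
      by congr (_ `^ _); rewrite /s; lra.
    have -> : h t = s * (t `^ g * (1 + t) `^ (- g)) / (1 + t) ^+ 2.
      rewrite /h powRM ?invr_ge0 ?(ltW t0) ?(ltW t1)//.
      by rewrite -(powR_inv1 (ltW t1)) -powRrM mulN1r.
    by field; rewrite !gt_eqF.
  apply: ler_wpM2l; rewrite ?powR_ge0// expRN_le_powR//; lra.
pose F n : set R := `[n.+1%:R^-1, n.+2%:R]%classic.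
have Fpos n x : F n x -> 0 < x.
  by rewrite /F /= in_itv /= => /andP[h1 _]; apply: lt_le_trans h1; rewrite invr_gt0.
have Fn n : n.+1%:R^-1 < n.+2%:R :> R.
  apply: (@le_lt_trans _ _ 1); first by rewrite invf_le1// ler1n.
  by rewrite ltr1n.
have mF n : measurable (F n : set (measurableTypeR R)) by exact: measurable_itv.
have mg (A : set (measurableTypeR R)) : measurable_fun A (EFin \o gamma_density g).
  by apply/measurable_EFinP/measurable_funTS; exact: measurable_gamma_density.
have bnd n : (\int[leb]_(x in F n) (gamma_density g x)%:E <= (M / s)%:E)%E.
  have hc x : 0 < x -> {for x, continuous h}.
    move=> x0; have x1 : 0 < 1 + x by lra.
    have d1 : is_derive x (1 : R) (fun x => 1 + x) 1.
      by apply: is_derive_eq; ring.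
    have d2 := is_derive1V d1 (lt0r_neq0 x1).
    have d3 : is_derive x (1 : R) (fun x => x / (1 + x)) _ :=
      is_deriveM (is_derive_id _ _) d2.
    have q0 : 0 < x / (1 + x) by rewrite divr_gt0.
    have d4 := is_derive1_compose d3 (is_derive1_powR g q0).
    have d5 : is_derive x (1 : R) (fun x => (1 + x) ^+ 2) _ := is_deriveX 2 d1.
    have n6 : (1 + x) ^+ 2 != 0 by rewrite expf_neq0// lt0r_neq0.
    have d6 := is_derive1V d5 n6.
    exact: (is_derive_continuous
      (is_deriveM (is_deriveM (is_derive_cst s x 1) d4) d6)).
  have wc : {within F n, continuous (fun x => M / s * h x)}.
    apply: continuous_in_subspaceT => x; rewrite inE => /Fpos x0.
    by apply: cvgM; [exact: cvg_cst|exact: hc].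
  apply: (@le_trans _ _ (\int[leb]_(x in F n) (M / s * h x)%:E)%E).
    apply: ge0_le_integral => //.
    - by move=> x _; rewrite lee_fin gamma_density_ge0.
    - apply/measurable_EFinP.
      apply: subspace_continuous_measurable_fun; first exact: mF.
      exact: wc.
    - by move=> x /Fpos x0; rewrite lee_fin gh.
  have dMH x : n.+1%:R^-1 <= x <= n.+2%:R ->
      is_derive x 1 (fun x => M / s * H x) (M / s * h x).
    move=> xF; apply: (is_derive_eq (is_deriveZ (M / s) (dH x _))) => //.
    by apply: (Fpos n); rewrite /F /= in_itv.
  have cMh x : n.+1%:R^-1 <= x <= n.+2%:R ->
      {for x, continuous (fun x => M / s * h x)}.
    move=> xF; have x0 : 0 < x by apply: (Fpos n); rewrite /F /= in_itv.
    by apply: cvgM; [exact: cvg_cst|exact: hc].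
  rewrite (FTC_closed (Fn n) dMH cMh) lee_fin -mulrBr.
  rewrite ler_piMr//; first by rewrite divr_ge0// ltW.
  have : H n.+2%:R <= 1.
    have -> : 1 = 1 `^ s :> R by rewrite powR1.
    apply: ge0_ler_powR; rewrite ?nnegrE ?divr_ge0 ?(ltW s0)//.
    have n1 : 0 < 1 + n.+2%:R :> R by rewrite addr_gt0.
    by rewrite ler_pdivrMr// mul1r lerDr.
  have : 0 <= H n.+1%:R^-1 by exact: powR_ge0.
  lra.
have Fc := @ge0_nondecreasing_set_cvg_integral _ (measurableTypeR R) R F
  (EFin \o gamma_density g) leb.
have -> : (\int[leb]_x (gamma_density g x)%:E =
    \int[leb]_(x in \bigcup_i F i) (gamma_density g x)%:E)%E.
  rewrite [RHS]integral_mkcond; apply: eq_integral => x _.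
  rewrite patchE; case: ifPn => //.
  rewrite /gamma_density indicE; case: (ltP 0 x) => x0.
    rewrite notin_setE => /(_ _)[]; have xy : 0 < x + x^-1.
      by rewrite addr_gt0// invr_gt0.
    pose n := Num.bound (x + x^-1).
    have xn : x + x^-1 < n%:R by rewrite archi_boundP// ltW.
    exists n => //; rewrite /F /= in_itv /=; apply/andP; split.
      rewrite invf_ple ?posrE// ltW//.
      apply: (@lt_trans _ _ n%:R); last by rewrite ltr_nat.
      by apply: le_lt_trans xn; rewrite lerDr ltW.
    apply: ltW; apply: (@lt_trans _ _ n%:R); last by rewrite ltr_nat.
    by apply: le_lt_trans xn; rewrite lerDl invr_ge0 ltW.
  by move=> _; rewrite memNset ?mulr0//= in_itv /= andbT ltNge x0.
apply: (@le_lt_trans _ _ (M / s)%:E); last exact: ltry.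
apply: (cvge_le _ (Fc _ _ _ _)) => //.
- by near=> n; exact: bnd.
- move=> m n mn; apply/subsetPset => x; rewrite /F /= !in_itv /= => /andP[h1 h2].
  apply/andP; split.
    by apply: le_trans h1; rewrite lef_pV2 ?posrE// ler_nat.
  by apply: le_trans h2 _; rewrite ler_nat.
- by move=> i x _; rewrite lee_fin gamma_density_ge0.
Unshelve. all: by end_near. Qed.

End gamma_finite.

(** * Gamma, Beta and Gauss integrals *)

Section gamma_beta.
Context {R : realType}.
Notation leb := (@lebesgue_measure R).
Implicit Types (s t x y g : R).

Lemma Gamma_integral s : 0 < s ->
  (\int[leb]_x (gamma_density (s - 1) x)%:E = (Gamma s)%:E)%E.
Proof.
move=> s0.
have E : (\int[leb]_(t in `]0%R, +oo[) (t `^ (s - 1) * expR (- t))%:E =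
    \int[leb]_x (gamma_density (s - 1) x)%:E)%E.
  rewrite integral_mkcond; apply: eq_integral => x _.
  rewrite patchE /gamma_density indicE.
  by case: (x \in _); rewrite ?mulr1 ?mulr0.
rewrite /Gamma /Rintegral E fineK// ge0_fin_numE.
  by apply: gamma_integral_lty; lra.
by apply: integral_ge0 => x _; rewrite lee_fin gamma_density_ge0.
Qed.

Lemma Gamma_gt0 s : 0 < s -> 0 < Gamma s.
Proof.
move=> s0; rewrite -lte_fin -Gamma_integral//; set g := s - 1.
(* A lower bound for t^g exp(-t) on [1, 2], where 0 <= ln t <= 2. *)
pose m := expR (- (`|g| * 2) - 2).
have m0 : 0 < m by exact: expR_gt0.
have mg (A : set (measurableTypeR R)) : measurable_fun A (EFin \o gamma_density g).
  by apply/measurable_EFinP/measurable_funTS; exact: measurable_gamma_density.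
apply: (@lt_le_trans _ _ (\int[leb]_(x in `[1%R, 2%R]) (gamma_density g x)%:E)%E);
  last first.
  apply: ge0_subset_integral => //.
  by move=> x _; rewrite lee_fin gamma_density_ge0.
apply: (@lt_le_trans _ _ (\int[leb]_(x in `[1%R, 2%R]) m%:E)%E).
  rewrite integral_cst//= lebesgue_measure_itv /= lte_fin ltr1n.
  by rewrite -EFinD -EFinM lte_fin mulr_gt0// subr_gt0 ltr1n.
apply: ge0_le_integral => //.
- by move=> x _; rewrite lee_fin ltW.
- move=> x /=; rewrite in_itv /= => /andP[x1 x2]; have x0 : 0 < x by lra.
  rewrite lee_fin /gamma_density indicE mem_set ?mulr1; last first.
    by rewrite /= in_itv /= x0.
  rewrite /powR gt_eqF// -expRD ler_expR.
  have := ln_ge0 x1; have := ln_sublinear x0; have := ler_norm (- g).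
  rewrite normrN; have := normr_ge0 g.
  move: (`|g|) (ln x) => a b; nra.
Qed.

Definition beta_density g x : R := (1 - x ^+ 2) `^ g * \1_(`]-1, 1[ : set R) x.

Lemma beta_density_ge0 g x : 0 <= beta_density g x.
Proof. by rewrite mulr_ge0 ?powR_ge0. Qed.

Lemma measurable_beta_density g :
  measurable_fun [set: measurableTypeR R] (beta_density g).
Proof.
apply: measurable_funM => //.
apply: measurableT_comp (measurable_powR _) _.
by apply: measurable_funB => //; exact: measurable_funX.
Qed.

Lemma sqr_lt1 x : (x ^+ 2 < 1) = (-1 < x < 1).
Proof. by rewrite -ltr_norml -[RHS](@expr_lt1 _ 2)// real_normK ?num_real. Qed.

Lemma gamma_beta_scale g s x : 0 < s ->
  gamma_density g (s - (Num.sqrt s * x) ^+ 2) * expR (- (Num.sqrt s * x) ^+ 2) =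
  s `^ g * expR (- s) * beta_density g x.
Proof.
move=> s0; rewrite exprMn sqr_sqrtr ?(ltW s0)//.
rewrite /gamma_density /beta_density !indicE.
have -> : s - s * x ^+ 2 = s * (1 - x ^+ 2) by ring.
have -> : (s * (1 - x ^+ 2) \in (`]0, +oo[%classic : set R)) =
    (x \in (`]-1, 1[%classic : set R)).
  by apply/idP/idP; rewrite !inE /= !in_itv /= andbT pmulr_rgt0// subr_gt0 sqr_lt1.
case: (boolP (x \in _)) => [|_]; last by rewrite !mulr0 mul0r.
rewrite inE /= in_itv /= => xI.
have x2 : 0 <= 1 - x ^+ 2.
  by rewrite subr_ge0 ltW// sqr_lt1.
rewrite powRM ?(ltW s0)// !mulr1.
have -> : expR (- s) = expR (- (s * (1 - x ^+ 2))) * expR (- (s * x ^+ 2)).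
  by rewrite -expRD; congr expR; ring.
ring.
Qed.

(** The function [gamma_density g (s - y^2) * exp (- y^2)] of [(s, y)] is
integrated over the plane in both orders. For fixed [s > 0] the substitution
[y = sqrt s * x] yields [s^(g + 1/2) exp (- s)] times the Beta integral, and
for fixed [y] the translation [s = t + y^2] yields
[Gamma (g + 1) exp (- y^2)]; this evaluates the Beta integral by means of the
Gauss integral. *)
Lemma beta_gamma_gauss g : -1 < g ->
  ((\int[leb]_x (beta_density g x)%:E) * (Gamma (g + 3 / 2))%:E =
  (Gamma (g + 1) * Num.sqrt pi)%:E)%E.
Proof.
move=> g1.
pose F (p : measurableTypeR R * measurableTypeR R) : \bar R :=
  (gamma_density g (p.1 - p.2 ^+ 2) * expR (- p.2 ^+ 2))%:E.
have mF : measurable_fun setT F.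
  apply/measurable_EFinP; apply: measurable_funM.
    apply: measurableT_comp; first exact: measurable_gamma_density.
    apply: measurable_funB => //; apply: measurable_funX; exact: measurable_snd.
  apply: measurableT_comp => //; apply: measurableT_comp => //.
  apply: measurable_funX; exact: measurable_snd.
have F0 p : (0 <= F p)%E.
  by rewrite lee_fin mulr_ge0 ?gamma_density_ge0 ?expR_ge0.
have mb : measurable_fun setT (EFin \o beta_density g).
  by apply/measurable_EFinP; exact: measurable_beta_density.
have mG (h : R) : measurable_fun setT (EFin \o gamma_density h).
  by apply/measurable_EFinP; exact: measurable_gamma_density.
have lhsE : (\int[leb]_x \int[leb]_y F (x, y) =
    \int[leb]_x (gamma_density (g + 1/2) x)%:E * \int[leb]_x (beta_density g x)%:E)%E.
  rewrite -ge0_integralZr//; last 3 first.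
  - exact: mG.
  - by move=> x _; rewrite lee_fin gamma_density_ge0.
  - by apply: integral_ge0 => x _; rewrite lee_fin beta_density_ge0.
  apply: eq_integral => s _.
  case: (ltP 0 s) => s0; last first.
    rewrite [in RHS]/gamma_density indicE memNset ?mulr0 ?mul0e; last first.
      by rewrite /= in_itv /= andbT ltNge s0.
    rewrite integral0_eq// => y _; rewrite /F /gamma_density indicE memNset.
      by rewrite mulr0 mul0r.
    rewrite /= in_itv /= andbT; apply/negP; rewrite -leNgt.
    by rewrite subr_le0 (le_trans s0)// sqr_ge0.
  have q0 : 0 < Num.sqrt s by rewrite sqrtr_gt0.
  rewrite (ge0_integral_affine 0 q0)//; last first.
    by apply: measurableT_comp => //; exact: measurable_pair1.
  under eq_integral => x _ do
    rewrite /F /= addr0 (gamma_beta_scale g x s0) EFinM.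
  rewrite ge0_integralZl//; last 2 first.
  - by move=> x _; rewrite lee_fin beta_density_ge0.
  - by rewrite lee_fin mulr_ge0 ?powR_ge0 ?expR_ge0.
  rewrite muleA -EFinM; congr (_%:E * _)%E.
  rewrite /gamma_density indicE mem_set ?mulr1; last by rewrite /= in_itv /= s0.
  rewrite mulrA; congr (_ * _).
  rewrite powRD ?(gt_eqF s0) ?implybT// mulrC; congr (_ * _).
  by rewrite mul1r powR12_sqrt// ltW.
have rhsE : (\int[leb]_y \int[leb]_x F (x, y) =
    (Gamma (g + 1))%:E * \int[leb]_y (expR (- y ^+ 2))%:E)%E.
  rewrite -ge0_integralZl//; last 2 first.
  - apply/measurable_EFinP; apply: measurableT_comp => //.
    by apply: measurableT_comp => //; exact: measurable_funX.
  - by rewrite lee_fin Gamma_ge0.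
  apply: eq_integral => y _.
  under eq_integral => x _ do rewrite /F /= EFinM.
  rewrite ge0_integralZr//; last 2 first.
  - apply/measurable_EFinP; apply: measurableT_comp.
      exact: measurable_gamma_density.
    exact: measurable_funB.
  - by move=> x _; rewrite lee_fin gamma_density_ge0.
  congr (_ * _)%E.
  rewrite -Gamma_integral; last by lra.
  rewrite addrK [RHS](@ge0_integral_affine R 1 (- y ^+ 2))//; last 2 first.
  - exact: mG.
  - by move=> x; rewrite lee_fin gamma_density_ge0.
  by rewrite mul1e; apply: eq_integral => x _; rewrite mul1r.
have fub := fubini_tonelli (m1 := leb) (m2 := leb) F mF F0.
have := etrans (esym lhsE) (etrans fub rhsE).
have -> : g + 1 / 2 = (g + 3 / 2) - 1 by lra.
rewrite Gamma_integral; last by lra.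
have -> : (\int[leb]_y (expR (- y ^+ 2))%:E = (Num.sqrt pi)%:E)%E.
  by rewrite -integralT_gauss.
by rewrite muleC EFinM.
Qed.

End gamma_beta.

(** * Weights (1 - x^2)^g on [-1, 1] *)

Section jacobi_measures.
Context {R : realType}.
Notation leb := (@lebesgue_measure R).
Implicit Types (K g x : R).

(** Both the ultraspherical and the Wigner measure have a density of this
form, so that the analysis below is made once and applied to each of them. *)
Definition jacobi_pdf K g x : R :=
  K * (1 - x ^+ 2) `^ g * \1_(`[-1, 1] : set R) x.

Lemma jacobi_pdf_ge0 K g x : 0 <= K -> 0 <= jacobi_pdf K g x.
Proof. by move=> K0; rewrite !mulr_ge0 ?powR_ge0. Qed.

Lemma measurable_jacobi_pdf K g :
  measurable_fun [set: measurableTypeR R] (jacobi_pdf K g).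
Proof.
apply: measurable_funM => //; apply: measurable_funM => //.
apply: measurableT_comp (measurable_powR _) _.
by apply: measurable_funB => //; exact: measurable_funX.
Qed.

Lemma jacobi_mass K g : 0 <= K ->
  (\int[leb]_x (jacobi_pdf K g x)%:E =
   K%:E * \int[leb]_x (beta_density g x)%:E)%E.
Proof.
move=> K0; rewrite -ge0_integralZl//; last 2 first.
- by apply/measurable_EFinP; exact: measurable_beta_density.
- by move=> x _; rewrite lee_fin beta_density_ge0.
pose f x : \bar R := (K * (1 - x ^+ 2) `^ g)%:E.
have mf (D : set (measurableTypeR R)) : measurable_fun D f.
  apply/measurable_EFinP/measurable_funTS; apply: measurable_funM => //.
  apply: measurableT_comp (measurable_powR _) _.
  by apply: measurable_funB => //; exact: measurable_funX.
transitivity (\int[leb]_(x in `[(-1)%R, 1%R]) f x)%E.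
  rewrite [RHS]integral_mkcond; apply: eq_integral => x _.
  rewrite patchE /jacobi_pdf /f indicE.
  by case: (x \in _); rewrite ?mulr1 ?mulr0.
transitivity (\int[leb]_(x in `](-1)%R, 1%R[) f x)%E.
  by apply: integral_itv_bndoo; exact: mf.
rewrite [LHS]integral_mkcond; apply: eq_integral => x _.
rewrite patchE /beta_density /f indicE -EFinM.
by case: (x \in _); rewrite ?mulr1 ?mulr0.
Qed.

Lemma ultraspherical_pdfE g : ultraspherical_pdf g =
  jacobi_pdf (Gamma (g + 3 / 2) / (Num.sqrt pi * Gamma (g + 1))) g :> (R -> R).
Proof. by []. Qed.

Lemma ultraspherical_mass g : -1 < g -> ultraspherical g setT = 1%E.
Proof.
move=> g1; rewrite /ultraspherical /with_density ultraspherical_pdfE.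
have G1 : 0 < Gamma (g + 1) by apply: Gamma_gt0; lra.
have G3 : 0 < Gamma (g + 3 / 2) by apply: Gamma_gt0; lra.
have p0 : 0 < Num.sqrt pi :> R by rewrite sqrtr_gt0 pi_gt0.
rewrite jacobi_mass; last first.
  by apply: divr_ge0; [|apply: mulr_ge0]; rewrite ?sqrtr_ge0 ?Gamma_ge0.
have := beta_gamma_gauss g1.
have : (0 <= \int[leb]_x (beta_density g x)%:E)%E.
  by apply: integral_ge0 => x _; rewrite lee_fin beta_density_ge0.
case: (\int[leb]_x _)%E => [b||] //; last by move=> _; rewrite gt0_mulye.
rewrite lee_fin -!EFinM => b0 [H]; congr EFin.
have {H} -> : b = Gamma (g + 1) * Num.sqrt pi / Gamma (g + 3 / 2).
  by rewrite -H mulfK// gt_eqF.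
move: (Gamma _) G1 (Gamma _) G3 (Num.sqrt _) p0 => u u0 v v0 w w0.
by field; rewrite !gt_eqF.
Qed.

Lemma wigner_pdfE : wigner_pdf = jacobi_pdf (2 / pi) (1 / 2) :> (R -> R).
Proof.
apply/funext => x; rewrite /wigner_pdf /jacobi_pdf indicE.
case: (boolP (x \in _)) => [|_]; last by rewrite !mulr0.
rewrite inE /= in_itv /= -ler_norml => x1.
rewrite mul1r powR12_sqrt ?mulrA; first by congr (_ * _); rewrite mulrAC.
by rewrite subr_ge0 -real_normK ?num_real// expr_le1.
Qed.

(** The antiderivative uses [arcsin x = 2 arctan (x / (1 + sqrt (1 - x^2)))],
whose right-hand side is regular up to the endpoints. *)
Lemma wigner_mass : wigner setT = 1%E :> \bar R.
Proof.
rewrite /wigner /with_density.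
pose q x : R := Num.sqrt (1 - x ^+ 2).
pose F x : R := 2 / pi * (x * q x / 2 + atan (x / (1 + q x))).
have cq : continuous q.
  move=> x; apply: (@continuous_comp _ _ _ (fun x : R => 1 - x ^+ 2) Num.sqrt).
    by apply: cvgB; [exact: cvg_cst|exact: exprn_continuous].
  exact: sqrt_continuous.
have q1 x : 0 < 1 + q x by rewrite ltr_pwDl// sqrtr_ge0.
have cF : continuous F.
  move=> x; apply: cvgM; first exact: cvg_cst.
  apply: cvgD.
    by apply: cvgM; [apply: cvgM; [exact: cvg_id|exact: cq]|exact: cvg_cst].
  apply: (@continuous_comp _ _ _ (fun x : R => x / (1 + q x)) atan).
    apply: cvgM; first exact: cvg_id.
    apply: cvgV; first by rewrite gt_eqF.
    by apply: cvgD; [exact: cvg_cst|exact: cq].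
  exact: continuous_atan.
have dF x : x \in `]-1, 1[ -> is_derive x 1 F (2 / pi * q x).
  rewrite in_itv /= => xI; have x1 : 0 < 1 - x ^+ 2 by rewrite subr_gt0 sqr_lt1.
  have q0 : 0 < q x by rewrite sqrtr_gt0.
  have d1 : is_derive x (1 : R) (fun x => 1 - x ^+ 2) (- (2 * x)).
    by apply: is_derive_eq; rewrite -![_ *: _]/(_ * _); ring.
  have d2 : is_derive x (1 : R) q _ :=
    is_derive1_compose d1 (is_derive1_sqrt x1).
  have d3 : is_derive x (1 : R) (fun x => 1 + q x) _ :=
    is_deriveD (is_derive_cst (1 : R) x (1 : R)) d2.
  have d4 := is_derive1V d3 (lt0r_neq0 (q1 x)).
  have d5 : is_derive x (1 : R) (fun x => x / (1 + q x)) _ :=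
    is_deriveM (is_derive_id _ _) d4.
  have d6 := is_derive1_compose d5 (is_derive1_atan _).
  have d7 : is_derive x (1 : R) (fun x => x * q x / 2) _ :=
    is_deriveM (is_deriveM (is_derive_id _ _) d2) (is_derive_cst (2^-1 : R) x (1 : R)).
  apply: (is_derive_eq (is_deriveZ (2 / pi) (is_deriveD d7 d6))).
  rewrite -![_ *: _]/(_ * _); congr (_ * _).
  have q2 : q x ^+ 2 = 1 - x ^+ 2 by rewrite sqr_sqrtr// ltW.
  have x2 : x ^+ 2 = 1 - q x ^+ 2 by rewrite q2; ring.
  have q1x := q1 x.
  rewrite -/(q x); move: (q x) q0 q1x x2 {q2} => r r0 r1 x2.
  have -> : 1 + (x / (1 + r)) ^+ 2 = 2 / (1 + r).
    by rewrite expr_div_n x2; field; rewrite gt_eqF.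
  rewrite mulr0 add0r.
  transitivity ((r - x ^+ 2 / r) / 2 +
      (1 + r) / 2 * (x ^+ 2 / (r * (1 + r) ^+ 2) + (1 + r)^-1)).
    by rewrite /cst; field; rewrite !gt_eqF.
  by rewrite x2; field; rewrite !gt_eqF.
transitivity (\int[leb]_(x in `[(-1)%R, 1%R]) (2 / pi * q x)%:E)%E.
  rewrite [RHS]integral_mkcond; apply: eq_integral => x _.
  rewrite patchE /wigner_pdf indicE -/(q x).
  by case: (x \in _); rewrite ?mulr1 ?mulr0// mulrAC.
rewrite (@continuous_FTC2 R _ F).
- rewrite /F /q sqrrN !expr1n subrr sqrtr0 addr0 !divr1 mulr0 mul0r add0r.
  rewrite mulr0 mul0r add0r atanN atan1 -EFinB; congr EFin.
  by move: (@pi R) (pi_gt0 R) => p p0; field; rewrite gt_eqF.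
- lra.
- apply: continuous_subspaceT => x; apply: cvgM; [exact: cvg_cst|exact: cq].
- split.
  + by move=> x xI; have [] := dF x xI.
  + by apply: cvg_at_right_filter; exact: cF.
  + by apply: cvg_at_left_filter; exact: cF.
- by move=> x xI; rewrite derive1E; have [_ ->] := dF x xI.
Qed.

End jacobi_measures.

(** * The Stieltjes kernel *)

(** The kernel [(z - x)^(-p)]. It is locked, and so is the integral [CintI]
below: two transforms are to be compared through the orders [p] and the points
[z], never through the logarithms hidden inside. *)
HB.lock Definition skernel {R : realType} (z : R[i]) (p x : R) : R[i] :=
  Cpow (z - x%:C) (- p).

Section kernel.
Context {R : realType}.
Implicit Types (z : R[i]) (p q x s : R).

Definition off_cut z : bool := (complex.Im z != 0) || (1 < complex.Re z).

Lemma off_cut_slit z x : off_cut z -> x <= 1 -> slit (z - x%:C).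
Proof.
rewrite /off_cut /slit cReD cImD cReN cImN /= oppr0 addr0 => /orP[->//|z1] x1.
by apply/orP; right; lra.
Qed.

Lemma off_cut_shift z s : off_cut z -> 0 <= s -> off_cut (z + s%:C).
Proof.
rewrite /off_cut cReD cImD /= addr0 => /orP[->//|z1] s0.
by apply/orP; right; lra.
Qed.

Lemma skernelE z p x : skernel z p x = Cpow (z - x%:C) (- p).
Proof. by rewrite unlock. Qed.

Lemma skernel_fun z p : skernel z p = fun x => Cpow (z - x%:C) (- p).
Proof. by rewrite unlock. Qed.

Lemma skernelM z p x : slit (z - x%:C) ->
  (z - x%:C) * skernel z (p + 1) x = skernel z p x.
Proof.
move=> sz; rewrite !skernelE -{1}(Cpow1 sz) -CpowD; congr Cpow; ring.
Qed.

Lemma is_cderive_skernel z p x : slit (z - x%:C) ->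
  is_cderive x (skernel z p) (p%:C * skernel z (p + 1) x).
Proof.
move=> sz; have dz : is_cderive x (fun x => z - x%:C) (- 1).
  apply: (is_cderive_eq (is_cderiveB (is_cderive_cst x z)
    (is_cderive_real (is_derive_id x 1)))).
  by rewrite sub0r.
rewrite skernel_fun.
apply: (is_cderive_eq (is_cderive_Cpow (- p) sz dz)).
rewrite -skernelE -skernelM// rmorphN /=.
by field; exact: slit_neq0.
Qed.

Lemma is_cderive_skernel_shift z p x s : slit (z + s%:C - x%:C) ->
  is_cderive s (fun s => skernel (z + s%:C) p x)
    (- p%:C * skernel (z + s%:C) (p + 1) x).
Proof.
move=> sz; have dz : is_cderive s (fun s => z + s%:C - x%:C) 1.
  apply: (is_cderive_eq (is_cderiveB (is_cderiveD (is_cderive_cst s z)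
    (is_cderive_real (is_derive_id s 1))) (is_cderive_cst s x%:C))).
  by rewrite subr0 add0r.
rewrite (_ : (fun s => _) = fun s => Cpow (z + s%:C - x%:C) (- p)); last first.
  by apply/funext => u; rewrite skernelE.
apply: (is_cderive_eq (is_cderive_Cpow (- p) sz dz)).
rewrite -skernelE -skernelM// rmorphN /=.
by field; exact: slit_neq0.
Qed.

Lemma cabs_skernel z p x : slit (z - x%:C) ->
  cabs (skernel z p x) = cabs (z - x%:C) `^ (- p).
Proof. by move=> sz; rewrite skernelE cabs_Cpow// slit_neq0. Qed.

(** Measurability is asserted on the whole line, hence also across the point
[x = z] when [z] is real; in that case the argument is a step function. *)
Lemma measurable_Carg_sub z :
  measurable_fun [set: R] (fun x => Carg (z - x%:C)).
Proof.
have [z0|z0] := eqVneq (complex.Im z) 0; last first.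
  rewrite (_ : (fun x => _) = fun x => Num.sg (complex.Im z) * (pi / 2)
      - atan ((complex.Re z - x) / complex.Im z)); last first.
    apply/funext => x; rewrite Carg_Im_neq0 cImD cImN /= oppr0 addr0//.
    by rewrite cReD cReN.
  apply: measurable_funB => //; apply: measurableT_comp.
    by apply: continuous_measurable_fun => x; exact: continuous_atan.
  by apply: measurable_funM => //; exact: measurable_funB.
rewrite (_ : (fun x => _) = fun x => if x < complex.Re z then 0 else
    if complex.Re z < x then pi else acos 0); last first.
  apply/funext => x; rewrite /Carg -/(cabs (z - x%:C)) cabsE !(cImD,cImN) z0 /=.
  rewrite subrr lexx expr0n addr0 sqrtr_sqr cReD cReN /=.
  case: ltgtP => [xz|zx|->].
  - by rewrite gtr0_norm ?subr_gt0// divff ?acos1// subr_eq0 gt_eqF.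
  - rewrite ltr0_norm ?subr_lt0// invrN mulrN divff ?acosN1//.
    by rewrite subr_eq0 lt_eqF.
  - by rewrite subrr mul0r.
apply: measurable_fun_ifT => //; first exact: measurable_fun_ltr.
by apply: measurable_fun_ifT => //; exact: measurable_fun_ltr.
Qed.

Lemma measurable_ln_cabs_sub z :
  measurable_fun [set: R] (fun x => ln (cabs (z - x%:C))).
Proof.
rewrite (_ : (fun x => _) = fun x =>
    ln (Num.sqrt ((complex.Re z - x) ^+ 2 + complex.Im z ^+ 2))); last first.
  by apply/funext => x; rewrite cabsE !(cReD,cReN,cImD,cImN) /= oppr0 addr0.
apply: measurableT_comp; first exact: measurable_ln.
apply: measurableT_comp (@continuous_measurable_fun R _ (@sqrt_continuous R)) _.
apply: measurable_funD => //; apply: measurable_funX.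
exact: measurable_funB.
Qed.

Lemma measurable_skernel z p :
  measurable_fun [set: R] (fun x => complex.Re (skernel z p x)) /\
  measurable_fun [set: R] (fun x => complex.Im (skernel z p x)).
Proof.
have mln := measurable_ln_cabs_sub z.
have marg := measurable_Carg_sub z.
have E x : (- p)%:C * Clog (z - x%:C) =
    (- p * ln (cabs (z - x%:C))) +i* (- p * Carg (z - x%:C)).
  by apply: complex_ext; rewrite ?cReM ?cImM /= mul0r ?subr0 ?addr0.
have mg f : measurable_fun [set: R] f -> measurable_fun [set: R] (fun x => - p * f x).
  by move=> mf; exact: measurable_funM.
split.
- rewrite (_ : (fun x => _) = fun x => expR (- p * ln (cabs (z - x%:C))) *
      cos (- p * Carg (z - x%:C))); last first.
    by apply/funext => x; rewrite skernelE /Cpow E.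
  apply: measurable_funM.
    by apply: measurableT_comp => //; exact: mg.
  apply: (measurableT_comp _ (mg _ marg)).
  by apply: continuous_measurable_fun => x; exact: continuous_cos.
- rewrite (_ : (fun x => _) = fun x => expR (- p * ln (cabs (z - x%:C))) *
      sin (- p * Carg (z - x%:C))); last first.
    by apply/funext => x; rewrite skernelE /Cpow E.
  apply: measurable_funM.
    by apply: measurableT_comp => //; exact: mg.
  apply: (measurableT_comp _ (mg _ marg)).
  by apply: continuous_measurable_fun => x; exact: continuous_sin.
Qed.

End kernel.

(** * Complex integrals over [-1, 1] *)

(** Integration is restricted to [-1, 1], which carries the measures at hand
and on which the kernel is bounded and continuous, while for real [z] the
kernel may be singular at [x = z]. *)
HB.lock Definition CintI {R : realType}
    (mu : {measure set (measurableTypeR R) -> \bar R}) (f : R -> R[i]) : R[i] :=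
  (\int[mu]_(x in `[(-1)%R, 1%R]) complex.Re (f x)) +i*
  (\int[mu]_(x in `[(-1)%R, 1%R]) complex.Im (f x)).

Lemma CintIE {R : realType}
    (mu : {measure set (measurableTypeR R) -> \bar R}) (f : R -> R[i]) :
  CintI mu f = (\int[mu]_(x in `[(-1)%R, 1%R]) complex.Re (f x)) +i*
    (\int[mu]_(x in `[(-1)%R, 1%R]) complex.Im (f x)).
Proof. by rewrite unlock. Qed.

Section complex_integral.
Context {R : realType}.
Implicit Types (f h : R -> R[i]) (a : R[i]) (x M : R).

(** Continuity at -1 and 1 is two-sided, as it is for the kernels, which
extend continuously past both endpoints. *)
Definition ccont f := forall x, -1 <= x <= 1 ->
  complex.Re (f y) @[y --> x] --> complex.Re (f x) /\
  complex.Im (f y) @[y --> x] --> complex.Im (f x).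

Lemma is_cderive_ccont f (d : R -> R[i]) :
  (forall x, -1 <= x <= 1 -> is_cderive x f (d x)) -> ccont f.
Proof.
by move=> fd x /fd[fx1 fx2]; split; [exact: is_derive_continuous fx1|
  exact: is_derive_continuous fx2].
Qed.

Lemma ccont_cst a : ccont (fun=> a).
Proof. by move=> x _; split; exact: cvg_cst. Qed.

Lemma ccont_real (f : R -> R) : continuous f -> ccont (fun x => (f x)%:C).
Proof. by move=> cf x _; split; [exact: cf|exact: cvg_cst]. Qed.

Lemma ccontD f h : ccont f -> ccont h -> ccont (fun x => f x + h x).
Proof.
move=> cf ch x xI; have [f1 f2] := cf x xI; have [h1 h2] := ch x xI; split.
- by under eq_fun do rewrite cReD; rewrite cReD; apply: cvgD.
- by under eq_fun do rewrite cImD; rewrite cImD; apply: cvgD.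
Qed.

Lemma ccontM f h : ccont f -> ccont h -> ccont (fun x => f x * h x).
Proof.
move=> cf ch x xI; have [f1 f2] := cf x xI; have [h1 h2] := ch x xI; split.
- by under eq_fun do rewrite cReM; rewrite cReM; apply: cvgB; apply: cvgM.
- by under eq_fun do rewrite cImM; rewrite cImM; apply: cvgD; apply: cvgM.
Qed.

Lemma ccontZ a f : ccont f -> ccont (fun x => a * f x).
Proof. by move=> cf; apply: ccontM => //; exact: ccont_cst. Qed.

Variable mu : {measure set (measurableTypeR R) -> \bar R}.
Hypothesis mu1 : mu `[-1, 1]%classic = 1%E.
Notation I := (`[(-1)%R, 1%R]%classic : set (measurableTypeR R)).

Lemma integrable_cont (f : R -> R) :
  (forall x, -1 <= x <= 1 -> {for x, continuous f}) ->
  mu.-integrable I (EFin \o f).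
Proof.
move=> cf; have wf : {within `[-1, 1], continuous f}.
  by apply: continuous_in_subspaceT => x; rewrite inE /= in_itv /=; exact: cf.
apply: measurable_bounded_integrable => //.
- by rewrite mu1 ltry.
- exact: subspace_continuous_measurable_fun.
- have /compact_bounded[M [_ mrt]] := continuous_compact wf (@segment_compact _ _ _).
  exists M; split; rewrite ?num_real // => ? ? ? ?.
  exact: mrt.
Qed.

Lemma integrable_ccont f : ccont f ->
  mu.-integrable I (EFin \o (fun x => complex.Re (f x))) /\
  mu.-integrable I (EFin \o (fun x => complex.Im (f x))).
Proof. by move=> cf; split; apply: integrable_cont => x /cf[]. Qed.

Lemma eq_CintI f h : (forall x, -1 <= x <= 1 -> f x = h x) -> CintI mu f = CintI mu h.
Proof.
move=> fh; rewrite !CintIE; congr (_ +i* _); apply: eq_Rintegral => x;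
by rewrite inE /= in_itv /= => /fh ->.
Qed.

Lemma CintID f h : ccont f -> ccont h ->
  CintI mu (fun x => f x + h x) = CintI mu f + CintI mu h.
Proof.
move=> /integrable_ccont[f1 f2] /integrable_ccont[h1 h2].
rewrite !CintIE; apply: complex_ext; rewrite ?cReD ?cImD /= -RintegralD//;
  apply: eq_Rintegral => x _.
- by rewrite cReD.
- by rewrite cImD.
Qed.

Lemma CintIZ a f : ccont f -> CintI mu (fun x => a * f x) = a * CintI mu f.
Proof.
move=> /[dup] cf /integrable_ccont[f1 f2].
have [r1 r2] : mu.-integrable I
    (EFin \o (fun x => complex.Re a * complex.Re (f x))) /\
    mu.-integrable I (EFin \o (fun x => complex.Im a * complex.Im (f x))).
  split; apply: integrable_cont => x /cf[c1 c2].
  - by apply: cvgM => //; exact: cvg_cst.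
  - by apply: cvgM => //; exact: cvg_cst.
have [i1 i2] : mu.-integrable I
    (EFin \o (fun x => complex.Re a * complex.Im (f x))) /\
    mu.-integrable I (EFin \o (fun x => complex.Im a * complex.Re (f x))).
  split; apply: integrable_cont => x /cf[c1 c2].
  - by apply: cvgM => //; exact: cvg_cst.
  - by apply: cvgM => //; exact: cvg_cst.
rewrite !CintIE; apply: complex_ext; rewrite ?cReM ?cImM /=.
- rewrite -!RintegralZl// -RintegralB//; apply: eq_Rintegral => x _.
  by rewrite cReM.
- rewrite -!RintegralZl// -RintegralD//; apply: eq_Rintegral => x _.
  by rewrite cImM.
Qed.

Lemma CintI_cst a : CintI mu (fun=> a) = a.
Proof.
by rewrite CintIE; apply: complex_ext => /=; rewrite Rintegral_cst//= mu1 /= mulr1.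
Qed.

(** The two coordinates are bounded separately, whence the factor 2; it is
harmless because the bound only serves asymptotic estimates. *)
Lemma cabs_CintI_le f M : ccont f ->
  (forall x, -1 <= x <= 1 -> cabs (f x) <= M) -> cabs (CintI mu f) <= M + M.
Proof.
move=> cf fM; have [f1 f2] := integrable_ccont cf.
have H (h : R -> R) : mu.-integrable I (EFin \o h) ->
    (forall x, -1 <= x <= 1 -> `|h x| <= M) -> `|\int[mu]_(x in I) h x| <= M.
  move=> ih hM; apply: le_trans (le_normr_Rintegral _ _) _ => //.
  have -> : M = \int[mu]_(x in I) M.
    by rewrite Rintegral_cst//= mu1 /= mulr1.
  apply: le_Rintegral => //.
  - exact: integrable_norm.
  - by apply: integrable_cont => x _; exact: cvg_cst.
rewrite CintIE (le_trans (cabs_le_ReIm _))//; apply: lerD; apply: H => // x xI.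
- by apply: le_trans (fM x xI); exact: Re_le_cabs.
- by apply: le_trans (fM x xI); exact: Im_le_cabs.
Qed.

End complex_integral.

(** * Differentiation under the integral *)

Section kernel_bounds.
Context {R : realType}.
Implicit Types (z : R[i]) (p q x s m M u : R).

(** A power is monotone, in a direction that depends on the sign of [q]; the
sum of the two end values dominates in both cases. *)
Lemma powR_le_ends q m M u : 0 < m -> m <= u <= M -> u `^ q <= m `^ q + M `^ q.
Proof.
move=> m0 /andP[mu uM]; have u0 : 0 < u by exact: lt_le_trans mu.
have M0 : 0 < M by exact: lt_le_trans uM.
have [q0|q0] := leP 0 q.
  apply: (@le_trans _ _ (M `^ q)); last by rewrite lerDr powR_ge0.
  by apply: ge0_ler_powR; rewrite ?nnegrE//; exact: ltW.
apply: (@le_trans _ _ (m `^ q)); last by rewrite lerDl powR_ge0.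
rewrite -(opprK q) powRN [leRHS]powRN lef_pV2 ?posrE ?powR_gt0//.
by apply: ge0_ler_powR; rewrite ?nnegrE//; first lra; exact: ltW.
Qed.

(** A positive lower bound for the distance from [z] to the cut, easier to
handle than this distance. *)
Definition cut_gap z : R :=
  if complex.Im z != 0 then `|complex.Im z| else complex.Re z - 1.

Lemma cut_gap_gt0 z : off_cut z -> 0 < cut_gap z.
Proof.
rewrite /off_cut /cut_gap; case: ifPn => [z0 _|_ /=]; first by rewrite normr_gt0.
by rewrite subr_gt0.
Qed.

Lemma cut_gap_le z x : off_cut z -> x <= 1 -> cut_gap z <= cabs (z - x%:C).
Proof.
rewrite /off_cut /cut_gap; case: ifPn => [z0 _ _|_ /= z1 x1].
  apply: le_trans _ (Im_le_cabs _).
  by rewrite cImD cImN /= oppr0 addr0.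
apply: le_trans _ (Re_le_cabs _).
by rewrite cReD cReN /= ger0_norm; lra.
Qed.

Lemma off_cut_near z s : off_cut z -> `|s| < cut_gap z -> off_cut (z + s%:C).
Proof.
rewrite /off_cut /cut_gap cReD cImD /= addr0; case: ifPn => [//|_ /= z1].
by move=> /ltr_normlP[h1 h2]; lra.
Qed.

(** The local uniform bound by which dominated convergence allows
differentiation under the integral. *)
Lemma cabs_skernel_near z q : off_cut z -> exists2 B, 0 <= B &
  forall s x, `|s| < cut_gap z / 2 -> -1 <= x <= 1 ->
  cabs (skernel (z + s%:C) q x) <= B.
Proof.
move=> zo; have d0 := cut_gap_gt0 zo.
exists ((cut_gap z / 2) `^ (- q) + (cabs z + cut_gap z / 2 + 1) `^ (- q)).
  by rewrite addr_ge0 ?powR_ge0.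
move=> s x sz xI; have /andP[x1 x2] := xI.
have zs : off_cut (z + s%:C) by apply: off_cut_near => //; lra.
rewrite cabs_skernel; last exact: off_cut_slit.
apply: powR_le_ends; first lra.
apply/andP; split.
  have := cut_gap_le zo x2.
  have -> : z - x%:C = (z + s%:C - x%:C) + (- s)%:C.
    by rewrite rmorphN /=; ring.
  move=> h; have := le_trans h (cabsD _ _); rewrite cabs_real normrN; lra.
apply: le_trans (cabsD _ _) _; rewrite cabsN cabs_real.
have := cabsD z s%:C; rewrite cabs_real.
have : `|x| <= 1 by rewrite ler_norml.
lra.
Qed.

Lemma ccont_skernel z q : off_cut z -> ccont (skernel z q).
Proof.
move=> zo; apply: is_cderive_ccont => x /andP[_ x1].
by apply: is_cderive_skernel; exact: off_cut_slit.
Qed.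

End kernel_bounds.

Section derivative_under_integral.
Context {R : realType}.
Variable mu : {measure set (measurableTypeR R) -> \bar R}.
Hypothesis mu1 : mu `[-1, 1]%classic = 1%E.
Notation I := (`[(-1)%R, 1%R]%classic : set (measurableTypeR R)).

Lemma is_derive_Rintegral (f df : R -> R -> R) (a d M : R) : 0 < d -> 0 <= M ->
  (forall s, `|s - a| < d -> mu.-integrable I (EFin \o f s)) ->
  (forall s x, `|s - a| < d -> -1 <= x <= 1 ->
    is_derive s 1 (f ^~ x) (df s x)) ->
  (forall s x, `|s - a| < d -> -1 <= x <= 1 -> `|df s x| <= M) ->
  is_derive a 1 (fun s => \int[mu]_(x in I) f s x) (\int[mu]_(x in I) df a x).
Proof.
move=> d0 M0 fi fd dfM.
have near_a s : `]a - d, a + d[%classic s -> `|s - a| < d.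
  by rewrite /= in_itv /= ltr_distl.
have Ia : `]a - d, a + d[%classic a by rewrite /= in_itv /=; apply/andP; lra.
have I_ x : I x -> -1 <= x <= 1 by rewrite /= in_itv.
have mI : measurable I by exact: measurable_itv.
have iM : mu.-integrable I (EFin \o (fun=> M)).
  by apply: integrable_cont => // x _; exact: cvg_cst.
have H1 : forall s, `]a - d, a + d[%classic s -> mu.-integrable I (EFin \o f s).
  by move=> s /near_a /fi.
have H2 : forall s x, `]a - d, a + d[%classic s -> I x -> derivable (f ^~ x) s 1.
  by move=> s x /near_a sa /I_ xI; have [] := fd s x sa xI.
have H3 : forall s x, `]a - d, a + d[%classic s -> I x ->
    `|partial1of2 f s x| <= M.
  move=> s x /near_a sa /I_ xI; rewrite partial1of2E.
  by have [_ ->] := fd s x sa xI; exact: dfM.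
have aa : `|a - a| < d by rewrite subrr normr0.
apply: DeriveDef; first exact: (derivable_under_integral mI Ia H1 H2 _ iM H3).
rewrite -derive1E (differentiation_under_integral mI Ia H1 H2 _ iM H3)//.
apply: eq_Rintegral => x; rewrite inE => /I_ xI.
by rewrite /= -/(partial1of2 f a x) partial1of2E; have [_ ->] := fd a x aa xI.
Qed.

Lemma is_cderive_CintI_skernel z p s : off_cut (z + s%:C) ->
  is_cderive s (fun s => CintI mu (skernel (z + s%:C) p))
    (- p%:C * CintI mu (skernel (z + s%:C) (p + 1))).
Proof.
move=> zs; rewrite -CintIZ //; last exact: ccont_skernel.
have [B B0 HB] := cabs_skernel_near (p + 1) zs.
have gap0 := cut_gap_gt0 zs.
have zsE u : z + u%:C = z + s%:C + (u - s)%:C by rewrite rmorphB /=; ring.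
have near_off u : `|u - s| < cut_gap (z + s%:C) / 2 -> off_cut (z + u%:C).
  by move=> us; rewrite zsE; apply: off_cut_near => //; lra.
have dk u x : `|u - s| < cut_gap (z + s%:C) / 2 -> -1 <= x <= 1 ->
    is_cderive u (fun s => skernel (z + s%:C) p x)
      (- p%:C * skernel (z + u%:C) (p + 1) x).
  move=> /near_off us /andP[_ x1]; apply: is_cderive_skernel_shift.
  exact: off_cut_slit.
have kB u x : `|u - s| < cut_gap (z + s%:C) / 2 -> -1 <= x <= 1 ->
    cabs (- p%:C * skernel (z + u%:C) (p + 1) x) <= `|p| * B.
  move=> us xI; rewrite cabsM cabsN cabs_real; apply: ler_wpM2l => //.
  by rewrite zsE; exact: HB.
have ki u : `|u - s| < cut_gap (z + s%:C) / 2 -> ccont (skernel (z + u%:C) p).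
  by move=> /near_off; exact: ccont_skernel.
have d0 : 0 < cut_gap (z + s%:C) / 2 by lra.
have M0 : 0 <= `|p| * B by rewrite mulr_ge0.
rewrite (_ : (fun s => _) = fun s =>
    (\int[mu]_(x in I) complex.Re (skernel (z + s%:C) p x)) +i*
    (\int[mu]_(x in I) complex.Im (skernel (z + s%:C) p x))); last first.
  by apply/funext => u; rewrite CintIE.
rewrite CintIE; split => /=.
- apply: (is_derive_Rintegral (f := fun s x => complex.Re (skernel (z + s%:C) p x))
    (df := fun s x => complex.Re (- p%:C * skernel (z + s%:C) (p + 1) x)) d0 M0).
  + by move=> u /ki /(integrable_ccont mu1)[].
  + by move=> u x us xI; have [] := dk u x us xI.
  + by move=> u x us xI; exact: le_trans (Re_le_cabs _) (kB u x us xI).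
- apply: (is_derive_Rintegral (f := fun s x => complex.Im (skernel (z + s%:C) p x))
    (df := fun s x => complex.Im (- p%:C * skernel (z + s%:C) (p + 1) x)) d0 M0).
  + by move=> u /ki /(integrable_ccont mu1)[].
  + by move=> u x us xI; have [] := dk u x us xI.
  + by move=> u x us xI; exact: le_trans (Im_le_cabs _) (kB u x us xI).
Qed.

End derivative_under_integral.

(** * Integration by parts and the contiguous relation *)

Section jacobi_integral.
Context {R : realType}.
Notation leb := (@lebesgue_measure R).
Variables (mu : {measure set (measurableTypeR R) -> \bar R}) (K g : R).
Hypotheses (K0 : 0 <= K) (g1 : -1 < g).
Hypothesis muE : forall A, measurable A ->
  mu A = (\int[leb]_(x in A) (jacobi_pdf K g x)%:E)%E.
Hypothesis mass : mu setT = 1%E.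
Notation I := (`[(-1)%R, 1%R]%classic : set (measurableTypeR R)).

Lemma Rintegral_jacobi (f : measurableTypeR R -> R) :
  measurable_fun setT f -> \int[mu]_x f x = \int[mu]_(x in I) f x.
Proof.
move=> mf; have mI : measurable I by exact: measurable_itv.
have j0 (x : measurableTypeR R) : 0 <= jacobi_pdf K g x by exact: jacobi_pdf_ge0.
rewrite (Rintegral_density (measurable_jacobi_pdf K g) j0 muE measurableT mf).
rewrite (Rintegral_density (measurable_jacobi_pdf K g) j0 muE mI); last first.
  exact: measurable_funTS.
rewrite [RHS]Rintegral_mkcond; apply: eq_Rintegral => x _.
rewrite patchE /jacobi_pdf indicE; case: (x \in _) => //.
by rewrite !mulr0.
Qed.

Lemma jacobi_itv_mass : mu I = 1%E.
Proof.
have mI : measurable I by exact: measurable_itv.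
rewrite -mass !muE// [LHS]integral_mkcond; apply: eq_integral => x _.
rewrite patchE /jacobi_pdf indicE; case: (x \in _) => //.
by rewrite !mulr0.
Qed.

Lemma gen_stieltjes_CintI z p :
  gen_stieltjes p mu z = CintI mu (skernel z p).
Proof.
have [m1 m2] := measurable_skernel z p.
rewrite /gen_stieltjes /Cintegral.
under eq_Rintegral => x _ do rewrite -CpowN.
under [X in _ +i* X]eq_Rintegral => x _ do rewrite -CpowN.
rewrite CintIE -!Rintegral_jacobi//.
by congr (_ +i* _); apply: eq_Rintegral => x _; rewrite skernelE.
Qed.

Lemma cvg_to_right0 (T : Type) (F : set_system T) (FF : Filter F) (h : T -> R) :
  h x @[x --> F] --> 0 -> (\forall x \near F, 0 < h x) ->
  h x @[x --> F] --> 0^'+.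
Proof.
move=> h0 hp A /= HA.
have := h0 _ HA; rewrite /= /nbhs /= => HF.
near=> x; have : 0 < h x by near: x.
by near: x.
Unshelve. all: by end_near. Qed.

(** Times the weight, the integrand is the derivative of
[w = K (1 - x^2)^(g + 1) u], and [w] vanishes at both endpoints because
[g + 1 > 0]. For [g < 0] the weight is unbounded, so [w] is not differentiable
up to the endpoints; it is instead compared with the indefinite integral,
their difference being continuous on [-1, 1] with zero derivative inside. *)
Lemma jacobi_integration_by_parts (u du : R -> R) :
  (forall x : R, -1 <= x <= 1 -> is_derive x 1 u (du x)) ->
  (forall x : R, -1 <= x <= 1 -> {for x, continuous du}) ->
  \int[mu]_(x in I) ((1 - x ^+ 2) * du x - 2 * (g + 1) * x * u x) = 0.
Proof.
move=> dU cdu.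
have cu (x : R) : -1 <= x <= 1 -> {for x, continuous u}.
  by move=> xI; exact: is_derive_continuous (dU x xI).
pose v x := (1 - x ^+ 2) * du x - 2 * (g + 1) * x * u x.
have cv (x : R) : -1 <= x <= 1 -> {for x, continuous v}.
  move=> xI; apply: cvgB; apply: cvgM; try by [exact: cu|exact: cdu].
  - by apply: cvgB; [exact: cvg_cst|exact: exprn_continuous].
  - by apply: cvgM; [exact: cvg_cst|exact: cvg_id].
have j0 (x : measurableTypeR R) : 0 <= jacobi_pdf K g x by exact: jacobi_pdf_ge0.
have mj := measurable_jacobi_pdf K g.
have mI : measurable I by exact: measurable_itv.
have iv := integrable_cont jacobi_itv_mass cv.
have mv : measurable_fun I v.
  by case/integrableP: iv => /measurable_EFinP.
rewrite (Rintegral_density mj j0 muE mI mv).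
pose f x := v x * jacobi_pdf K g x.
have fi : leb.-integrable I (EFin \o f).
  apply/integrableP; split.
    apply/measurable_EFinP/measurable_funM => //; exact: measurable_funTS.
  have /integrableP[_] := iv.
  rewrite (@ge0_integral_density _ _ _ leb mu _ mj j0 muE)//; last first.
    by apply: measurableT_comp => //; apply: measurable_int iv.
  congr (_ < _)%E; apply: eq_integral => x _ /=.
  by rewrite -EFinM /f normrM (ger0_norm (j0 x)).
pose w x := K * (1 - x ^+ 2) `^ (g + 1) * u x.
have g0 : g + 1 != 0 by rewrite gt_eqF// -ltrBlDr sub0r.
have w1 : w 1 = 0.
  by rewrite /w expr1n subrr powR0// mulr0 mul0r.
have wN1 : w (-1) = 0.
  by rewrite /w sqrrN expr1n subrr powR0// mulr0 mul0r.
have pos (x : R) : -1 < x < 1 -> 0 < 1 - x ^+ 2 by rewrite subr_gt0 sqr_lt1.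
have fE (x : R) : -1 < x < 1 -> f x = v x * (K * (1 - x ^+ 2) `^ g).
  move=> /andP[x1 x2]; rewrite /f /jacobi_pdf indicE mem_set ?mulr1//.
  by rewrite /= in_itv /= !ltW.
have d1 (x : R) : is_derive x (1 : R) (fun x => 1 - x ^+ 2) (- (2 * x)).
  by apply: is_derive_eq; rewrite -![_ *: _]/(_ * _); ring.
have c1 (x : R) := is_derive_continuous (d1 x).
have dw (x : R) : -1 < x < 1 -> is_derive x 1 w (f x).
  move=> xI; have x0 := pos x xI; have xc : -1 <= x <= 1.
    by case/andP: xI => x1 x2; rewrite !ltW.
  have d2 := is_derive1_compose (d1 x) (is_derive1_powR (g + 1) x0).
  apply: (is_derive_eq (is_deriveM (is_deriveM (is_derive_cst K x (1 : R)) d2)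
    (dU x xc))).
  rewrite -![_ *: _]/(_ * _) fE// addrK /v /cst /=.
  rewrite -[(_ * _ : R -> R) x]/(K * (1 - x ^+ 2) `^ (g + 1)).
  rewrite powRD ?(gt_eqF x0) ?implybT// powRr1 ?(ltW x0)//.
  ring.
have cf (x : R) : -1 < x < 1 -> {for x, continuous f}.
  move=> xI; have x0 := pos x xI; have xc : -1 <= x <= 1.
    by case/andP: xI => x1 x2; rewrite !ltW.
  have d2 := is_derive1_compose (d1 x) (is_derive1_powR g x0).
  rewrite /prop_for /continuous_at fE//.
  apply: (@cvg_trans _ ((fun x => v x * (K * (1 - x ^+ 2) `^ g)) @ x)).
    apply: near_eq_cvg; near=> y; rewrite fE//.
    have : y \in `]-1, 1[ by near: y; exact: near_in_itvoo.
    by rewrite in_itv.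
  apply: (@cvgM R R (nbhs x) _ v); first exact: cv.
  by apply: cvgM; [exact: cvg_cst|exact: is_derive_continuous d2].
have cp (F : set_system R) (FF : Filter F) : (1 - x ^+ 2) @[x --> F] --> 0 ->
    (\forall x \near F, -1 < x < 1) -> (1 - x ^+ 2) `^ (g + 1) @[x --> F] --> 0.
  move=> F1 F2; have g0' : 0 < g + 1 by rewrite -ltrBlDr sub0r.
  apply: cvg_comp (powR_cvg0 g0').
  apply: cvg_to_right0 => //; near=> x; apply: pos.
  by near: x.
have cw : {within `[-1, 1], continuous w}.
  apply/continuous_within_itvP; first lra.
  split.
  - move=> x; rewrite in_itv /= => xI.
    exact: is_derive_continuous (dw x xI).
  - rewrite wN1 -[X in _ --> X](mul0r (u (-1))).
    apply: cvgM; last by apply: cvg_at_right_filter; apply: cu; apply/andP; lra.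
    rewrite -[X in _ --> X](mulr0 K); apply: cvgM; first exact: cvg_cst.
    apply: cp.
      apply: cvg_at_right_filter.
      by have := c1 (-1); rewrite /prop_for /continuous_at sqrrN expr1n subrr.
    near=> x; apply/andP; split; near: x; first exact: nbhs_right_gt.
    by apply: nbhs_right_lt; lra.
  - rewrite w1 -[X in _ --> X](mul0r (u 1)).
    apply: cvgM; last by apply: cvg_at_left_filter; apply: cu; apply/andP; lra.
    rewrite -[X in _ --> X](mulr0 K); apply: cvgM; first exact: cvg_cst.
    apply: cp.
      apply: cvg_at_left_filter.
      by have := c1 1; rewrite /prop_for /continuous_at expr1n subrr.
    near=> x; apply/andP; split; near: x; last exact: nbhs_left_lt.
    by apply: nbhs_left_gt; lra.
pose G x := parameterized_integral leb (-1) x f.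
have cG : {within `[-1, 1], continuous G}.
  by apply: parameterized_integral_continuous => //; lra.
have dG (x : R) : -1 < x < 1 -> is_derive x 1 G (f x).
  move=> /[dup] xI /andP[x1 x2].
  have [dGx G'x] := continuous_FTC1_closed x2 fi x1 (cf x xI).
  apply: DeriveDef; first exact: dGx.
  rewrite -derive1E; exact: G'x.
have [|||c _] := @MVT_segment R (G \- w) (fun=> 0) (-1) 1.
- lra.
- move=> x; rewrite in_itv /= => xI.
  apply: (is_derive_eq (is_deriveB (dG x xI) (dw x xI))).
  by rewrite subrr.
- by move=> x; apply: cvgB; [exact: cG|exact: cw].
rewrite /= w1 wN1 mul0r !subr0 => /eqP; rewrite subr_eq0 => /eqP.
rewrite /G /parameterized_integral => ->.
by rewrite set_itv1 Rintegral_set1.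
Unshelve. all: by end_near. Qed.

End jacobi_integral.

Section contiguous.
Context {R : realType}.
Notation leb := (@lebesgue_measure R).
Variables (mu : {measure set (measurableTypeR R) -> \bar R}) (K g : R).
Hypotheses (K0 : 0 <= K) (g1 : -1 < g).
Hypothesis muE : forall A, measurable A ->
  mu A = (\int[leb]_(x in A) (jacobi_pdf K g x)%:E)%E.
Hypothesis mass : mu setT = 1%E.

Let mu1 := jacobi_itv_mass muE mass.

Lemma CintI_integration_by_parts (u du : R -> R[i]) : ccont du ->
  (forall x, -1 <= x <= 1 -> is_cderive x u (du x)) ->
  CintI mu (fun x => (1 - x ^+ 2)%:C * du x - (2 * (g + 1) * x)%:C * u x) = 0.
Proof.
move=> cdu dU; rewrite CintIE; apply: complex_ext => /=.
- rewrite -[RHS](jacobi_integration_by_parts K0 g1 muE mass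
    (u := fun x => complex.Re (u x)) (du := fun x => complex.Re (du x))).
  + apply: eq_Rintegral => x _.
    by rewrite cReD cReN !cReM /= !mul0r !subr0.
  + by move=> x /dU[].
  + by move=> x /cdu[].
- rewrite -[RHS](jacobi_integration_by_parts K0 g1 muE mass
    (u := fun x => complex.Im (u x)) (du := fun x => complex.Im (du x))).
  + apply: eq_Rintegral => x _.
    by rewrite cImD cImN !cImM /= !mul0r !addr0.
  + by move=> x /dU[].
  + by move=> x /cdu[].
Qed.

(** Integration by parts with [u = (z - x)^(- p - 1)]. Expanding [x] and
[1 - x^2] in powers of [z - x] leaves the three orders [p], [p + 1], [p + 2].
*)
Lemma contiguous_skernel z p : off_cut z ->
  (2 * (g + 1) - (p + 1))%:C * CintI mu (skernel z p)
  + (2 * (p - g))%:C * z * CintI mu (skernel z (p + 1))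
  + (p + 1)%:C * (1 - z ^+ 2) * CintI mu (skernel z (p + 1 + 1)) = 0.
Proof.
move=> zo; have ck q := ccont_skernel q zo.
have ckZ q a := ccontZ a (ck q).
have cdu := ckZ (p + 1 + 1) (p + 1)%:C.
have := CintI_integration_by_parts (u := skernel z (p + 1)) cdu.
rewrite -!CintIZ// -!CintID//; last exact: ccontD.
move=> <-; last first.
  by move=> x /andP[_ x1]; apply: is_cderive_skernel; exact: off_cut_slit.
apply: eq_CintI => x /andP[_ x1]; have sz := off_cut_slit zo x1.
rewrite -(skernelM p sz) -(skernelM (p + 1) sz).
rewrite !(rmorphB, rmorphM, rmorphD, rmorphXn, rmorph1, rmorph_nat) /=.
ring.
Qed.

End contiguous.

(** * The Wigner transform solves a quadratic equation *)

Section wigner_transform.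
Context {R : realType}.
Notation leb := (@lebesgue_measure R).
Notation W := (@wigner R).
Implicit Types (z : R[i]) (s x : R).

Lemma wignerE A : measurable A ->
  W A = (\int[leb]_(x in A) (jacobi_pdf (2 / pi) (1 / 2) x)%:E)%E.
Proof. by move=> mA; rewrite -wigner_pdfE. Qed.

Lemma wigner_cst_ge0 : 0 <= 2 / pi :> R.
Proof. by rewrite divr_ge0// pi_ge0. Qed.

Lemma wigner_itv_mass : W `[-1, 1]%classic = 1%E.
Proof. exact: jacobi_itv_mass wignerE wigner_mass. Qed.

Lemma measurable_inv_sub z :
  measurable_fun [set: R] (fun x => complex.Re (z - x%:C)^-1) /\
  measurable_fun [set: R] (fun x => complex.Im (z - x%:C)^-1).
Proof.
have ms : measurable_fun [set: R] (fun x => complex.Re z - x).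
  exact: measurable_funB.
have mn : measurable_fun [set: R]
    (fun x => ((complex.Re z - x) ^+ 2 + complex.Im z ^+ 2)^-1).
  rewrite (_ : (fun x => _) = fun x =>
      ((complex.Re z - x) ^+ 2 + complex.Im z ^+ 2) `^ (-1)); last first.
    by apply/funext => x; rewrite powR_inv1// addr_ge0// sqr_ge0.
  apply: measurableT_comp (measurable_powR _) _.
  by apply: measurable_funD => //; exact: measurable_funX.
split.
- rewrite (_ : (fun x => _) = fun x => (complex.Re z - x) *
      ((complex.Re z - x) ^+ 2 + complex.Im z ^+ 2)^-1); last first.
    by apply/funext => x; rewrite cReV !(cReD,cReN,cImD,cImN) /= oppr0 addr0.
  exact: measurable_funM.
- rewrite (_ : (fun x => _) = fun x => (- complex.Im z) *
      ((complex.Re z - x) ^+ 2 + complex.Im z ^+ 2)^-1); last first.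
    by apply/funext => x; rewrite cImV !(cReD,cReN,cImD,cImN) /= oppr0 addr0 mulNr.
  exact: measurable_funM.
Qed.

Lemma G_W_CintI z : off_cut z -> G_W z = CintI W (skernel z 1).
Proof.
move=> zo; have [m1 m2] := measurable_inv_sub z.
rewrite /G_W /stieltjes /Cintegral.
rewrite (Rintegral_jacobi wigner_cst_ge0 wignerE m1).
rewrite (Rintegral_jacobi wigner_cst_ge0 wignerE m2).
rewrite -[LHS](CintIE W (fun x => (z - x%:C)^-1)); apply: eq_CintI => x /andP[_ x1].
by rewrite skernelE CpowN Cpow1//; exact: off_cut_slit.
Qed.

Lemma off_cut_sqr_neq1 z : off_cut z -> z ^+ 2 - 1 != 0.
Proof.
move=> zo; rewrite subr_sqr_1 mulf_neq0//.
  have := slit_neq0 (off_cut_slit zo (lexx 1)).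
  by rewrite rmorph1.
have N1 : -1 <= 1 :> R by lra.
have := slit_neq0 (off_cut_slit zo N1).
by rewrite rmorphN1 opprK.
Qed.

(** The contiguous relation at order [0], where the integral is the total
mass. The integral on the left being minus the derivative of [G_W], this is a
linear differential equation for [G_W]. *)
Lemma G_W_contiguous z : off_cut z ->
  (z ^+ 2 - 1) * CintI W (skernel z (1 + 1)) = 2 - z * G_W z.
Proof.
move=> zo; have g1 : -1 < 1 / 2 :> R by lra.
have := contiguous_skernel wigner_cst_ge0 g1 wignerE wigner_mass 0 zo.
rewrite add0r -G_W_CintI//.
have -> : CintI W (skernel z 0) = 1.
  rewrite -[RHS](CintI_cst wigner_itv_mass); apply: eq_CintI => x _.
  by rewrite skernelE oppr0 Cpow0.
have -> : 2 * (1 / 2 + 1) - 1 = 2 :> R by field.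
have -> : 2 * (0 - 1 / 2) = - 1 :> R by field.
rewrite rmorphN1 rmorph_nat rmorph1 => H.
apply/eqP; rewrite -subr_eq0; apply/eqP; rewrite -[RHS]oppr0 -H; ring.
Qed.

Lemma is_cderive_G_W z s : off_cut (z + s%:C) ->
  is_cderive s (fun s => G_W (z + s%:C))
    (((z + s%:C) * G_W (z + s%:C) - 2) / ((z + s%:C) ^+ 2 - 1)).
Proof.
move=> zs; have d0 := cut_gap_gt0 zs.
apply: (near_is_cderive (f := fun s => CintI W (skernel (z + s%:C) 1))).
  near=> u; rewrite G_W_CintI//.
  have -> : z + u%:C = z + s%:C + (u - s)%:C by rewrite rmorphB /=; ring.
  apply: off_cut_near; first exact: zs.
  by rewrite distrC; near: u; exact: cvgr_dist_lt.
apply: is_cderive_eq (is_cderive_CintI_skernel wigner_itv_mass 1 zs) _.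
have := G_W_contiguous zs; have := off_cut_sqr_neq1 zs.
move: (z + s%:C) => u u0 H.
rewrite -opprB -H; field; exact: u0.
Unshelve. all: by end_near. Qed.

Lemma cabs_sub_ge z x : -1 <= x <= 1 -> cabs z - 1 <= cabs (z - x%:C).
Proof.
move=> xI; rewrite lerBlDr; apply: (@le_trans _ _ (cabs (z - x%:C) + `|x|)).
  by rewrite -cabs_real; apply: le_trans (cabsD _ _); rewrite subrK.
by rewrite lerD2l ler_norml.
Qed.

Lemma cabs_G_W_le z : off_cut z -> 1 < cabs z ->
  cabs (G_W z) <= 2 / (cabs z - 1).
Proof.
move=> zo z1; rewrite G_W_CintI//.
have -> : 2 / (cabs z - 1) = (cabs z - 1)^-1 + (cabs z - 1)^-1.
  by field; rewrite gt_eqF// subr_gt0.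
apply: (cabs_CintI_le wigner_itv_mass); first exact: ccont_skernel.
move=> x xI; have := cabs_sub_ge z xI => h.
case/andP: xI => _ x1; have sz := off_cut_slit zo x1.
rewrite cabs_skernel// powR_inv1 ?cabs_ge0// lef_pV2// posrE.
- by rewrite cabs_gt0 slit_neq0.
- by rewrite subr_gt0.
Qed.

Lemma cabs_shift_ge z s : s - cabs z <= cabs (z + s%:C).
Proof.
rewrite lerBlDr -(cabsN z).
apply: (@le_trans _ _ (cabs s%:C)); first by rewrite cabs_real ler_norm.
by apply: le_trans (cabsD _ _); rewrite addrAC subrr add0r.
Qed.

(** By the differential equation of [G_W], the left-hand side is a constant
multiple of [z^2 - 1] along horizontal half-lines. It remains bounded at
infinity, unlike [z^2 - 1], so the constant is 0. *)
Lemma G_W_quadratic z : off_cut z -> G_W z ^+ 2 - 4 * z * G_W z + 4 = 0.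
Proof.
move=> zo.
pose Q u : R[i] := G_W u ^+ 2 - 4 * u * G_W u + 4.
pose V s := Q (z + s%:C) / ((z + s%:C) ^+ 2 - 1).
have os s : 0 <= s -> off_cut (z + s%:C) by exact: off_cut_shift.
have dV s : 0 <= s -> is_cderive s V 0.
  move=> /os so; have n0 := off_cut_sqr_neq1 so.
  have dG := is_cderive_G_W so.
  have dz : is_cderive s (fun s => z + s%:C) 1.
    apply: (is_cderive_eq (is_cderiveD (is_cderive_cst s z)
      (is_cderive_real (is_derive_id s 1)))).
    by rewrite add0r.
  have dd := is_cderiveB (is_cderiveM dz dz) (is_cderive_cst s 1).
  have dQ := is_cderiveD (is_cderiveB (is_cderiveM dG dG)
    (is_cderiveM (is_cderiveZ 4 dz) dG)) (is_cderive_cst s 4).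
  apply: (is_cderive_eq (is_cderiveM dQ (is_cderiveV n0 dd))).
  move: (z + s%:C) n0 => u n0; move: (G_W u) => G.
  field; exact: n0.
have V0 s : 0 <= s -> V s = V 0 by exact: is_cderive0_cst.
have V00 : V 0 = 0.
  apply/eqP; rewrite -cabs_eq0 eq_le cabs_ge0 andbT.
  rewrite leNgt; apply/negP => w0; set w := cabs (V 0) in w0.
  (* At u = z + s one has |Q u| <= 21 and w |u^2 - 1| >= 48. *)
  pose s := cabs z + 3 + 48 / w.
  have q0 : 0 < 48 / w by rewrite divr_gt0.
  have s0 : 0 <= s by rewrite /s; have := cabs_ge0 z; lra.
  have := cabs_shift_ge z s; set m := cabs (z + s%:C) => ms.
  have m2 : 3 + 48 / w <= m by move: ms; rewrite /s; lra.
  have m1 : 1 < m by lra.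
  have t0 : 0 < m - 1 by lra.
  have Gm := cabs_G_W_le (os s s0) m1.
  have Gt : cabs (G_W (z + s%:C)) * (m - 1) <= 2 by rewrite -ler_pdivlMr.
  have VE : w * cabs ((z + s%:C) ^+ 2 - 1) = cabs (Q (z + s%:C)).
    by rewrite /w -(V0 s s0) -cabsM /V divfK// off_cut_sqr_neq1// os.
  have Qle : cabs (Q (z + s%:C)) <= 21.
    rewrite /Q; apply: le_trans (cabsD _ _) _; rewrite cabs_nat.
    have := cabsD (G_W (z + s%:C) ^+ 2) (- (4 * (z + s%:C) * G_W (z + s%:C))).
    rewrite cabsN expr2 !cabsM cabs_nat -/m.
    have := cabs_ge0 (G_W (z + s%:C)); move: (cabs (G_W _)) Gt => r rt r0.
    move: (cabs _) => A HA; nra.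
  have zle : m - 1 <= cabs ((z + s%:C) ^+ 2 - 1).
    have c1 : cabs (1 : R[i]) = 1 := cabs_nat 1.
    have := cabsD ((z + s%:C) ^+ 2 - 1) 1; rewrite subrK c1 expr2 cabsM -/m.
    move: (cabs _) => A HA; nra.
  have : w * (m - 1) <= 21.
    by apply: le_trans (ler_wpM2l (ltW w0) zle) _; rewrite VE.
  have : 48 <= w * (m - 1).
    have -> : 48 = w * (48 / w) by field; rewrite gt_eqF.
    by apply: ler_wpM2l; [exact: ltW|lra].
  lra.
move: V00; rewrite /V rmorph0 addr0 => /eqP.
by rewrite mulf_eq0 invr_eq0 (negbTE (off_cut_sqr_neq1 zo)) orbF => /eqP.
Qed.

End wigner_transform.

(** * The square root of z^2 - 1 attached to the Wigner transform *)

Section wigner_branch.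
Context {R : realType}.
Implicit Types (z u : R[i]) (s x e q : R).

(** The branch of [sqrt (z^2 - 1)] for which
[G_W z = 2 / (z + sqrt (z^2 - 1))], expressed through [G_W]: the sum of
[G_W_inv] and of this definition is [2 / G_W z]. *)
Definition G_W_sqrt z : R[i] := (G_W z)^-1 - G_W z / 4.

Lemma G_W_neq0 z : off_cut z -> G_W z != 0.
Proof.
move=> /G_W_quadratic; apply: contra_eq_neq => ->.
by rewrite expr0n mulr0 subr0 add0r pnatr_eq0.
Qed.

Lemma G_W_inv z : off_cut z -> z = (G_W z)^-1 + G_W z / 4.
Proof.
move=> zo; have := G_W_quadratic zo; have := G_W_neq0 zo.
move: (G_W z) => G G0 H.
have -> : G^-1 + G / 4 = z + (G ^+ 2 - 4 * z * G + 4) / (4 * G).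
  by field; rewrite G0.
by rewrite H mul0r addr0.
Qed.

(** If [G_W z] were a nonpositive real, so would be [z = 1 / G + G / 4], which
would then lie on the cut. *)
Lemma G_W_slit z : off_cut z -> slit (G_W z).
Proof.
move=> zo; apply/negPn/negP; rewrite /slit negb_or negbK -leNgt => /andP[/eqP iG rG].
have := G_W_inv zo; have := G_W_neq0 zo; move: zo; rewrite /off_cut.
have -> : G_W z = (complex.Re (G_W z))%:C by apply: complex_ext.
move: (complex.Re _) rG => r r0 zo rn zE.
have {}zE : z = (r^-1 + r / 4)%:C.
  by rewrite zE rmorphD fmorphV rmorphM /= fmorphV rmorph_nat.
move: zo; rewrite zE /= eqxx /= => h.
have : r^-1 <= 0 by rewrite invr_le0.
lra.
Qed.

Lemma G_W_sqrtE z : off_cut z -> G_W_sqrt z ^+ 2 = z ^+ 2 - 1.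
Proof.
move=> zo; rewrite {2}(G_W_inv zo) /G_W_sqrt; have := G_W_neq0 zo.
by move: (G_W z) => G G0; field.
Qed.

Lemma G_W_sqrt_neq0 z : off_cut z -> G_W_sqrt z != 0.
Proof.
move=> zo; have := off_cut_sqr_neq1 zo.
by rewrite -G_W_sqrtE// expf_eq0.
Qed.

Lemma is_cderive_G_W_path z s : off_cut (z + s%:C) ->
  is_cderive s (fun s => G_W (z + s%:C))
    (- G_W (z + s%:C) / G_W_sqrt (z + s%:C)).
Proof.
move=> zs; apply: (is_cderive_eq (is_cderive_G_W zs)).
rewrite -G_W_sqrtE//.
have := G_W_sqrt_neq0 zs; have := G_W_neq0 zs; have := G_W_inv zs.
move: (z + s%:C) => u; rewrite /G_W_sqrt; move: (G_W u) => G uE G0 S0.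
have n0 : 4 - G * G != 0.
  apply: contraNneq S0 => h; apply/eqP.
  have -> : G^-1 - G / 4 = (4 - G * G) / (4 * G).
    by field; rewrite G0.
  by rewrite h mul0r.
by rewrite uE; field; rewrite G0 mulNr n0.
Qed.

Lemma is_cderive_G_W_sqrt_path z s : off_cut (z + s%:C) ->
  is_cderive s (fun s => G_W_sqrt (z + s%:C))
    ((z + s%:C) / G_W_sqrt (z + s%:C)).
Proof.
move=> zs; have dG := is_cderive_G_W_path zs; have G0 := G_W_neq0 zs.
have dS : is_cderive s (fun s => (G_W (z + s%:C))^-1 - G_W (z + s%:C) / 4) _ :=
  is_cderiveB (is_cderiveV G0 dG) (is_cderiveM dG (is_cderive_cst s 4^-1)).
apply: (is_cderive_eq dS).
have S0 := G_W_sqrt_neq0 zs; have := G_W_inv zs.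
move: (z + s%:C) G0 S0 => u; move: (G_W u) (G_W_sqrt u) => G S G0 S0 ->.
by field; rewrite G0 S0.
Qed.

Lemma G_W_small z e : off_cut z -> 0 < e ->
  \forall s \near +oo, 0 <= s /\ cabs (G_W (z + s%:C)) < e.
Proof.
move=> zo e0; near=> s.
have s0 : 0 <= s by near: s; apply: nbhs_pinfty_ge; exact: num_real.
have sE : cabs z + 1 + 2 / e < s by near: s; apply: nbhs_pinfty_gt; exact: num_real.
have q0 : 0 < 2 / e by rewrite divr_gt0.
have m1 := cabs_shift_ge z s.
split => //; apply: le_lt_trans (cabs_G_W_le (off_cut_shift zo s0) _) _; first lra.
by rewrite ltr_pdivrMr; [rewrite mulrC -ltr_pdivrMr//; lra|lra].
Unshelve. all: by end_near. Qed.

End wigner_branch.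

(** * The relation between the orders l and l + 1 *)

Section base_cases.
Context {R : realType}.
Notation leb := (@lebesgue_measure R).
Variables (mu : {measure set (measurableTypeR R) -> \bar R}) (K g : R).
Hypotheses (K0 : 0 <= K) (g1 : -1 < g).
Hypothesis muE : forall A, measurable A ->
  mu A = (\int[leb]_(x in A) (jacobi_pdf K g x)%:E)%E.
Hypothesis mass : mu setT = 1%E.
Implicit Types (z u : R[i]) (s x q : R).

Let mu1 := jacobi_itv_mass muE mass.
Let l := g + 1 / 2.
Notation Phi q u := (CintI mu (skernel u q)).

(** At the order [l = g + 1/2] the coefficients of the contiguous relation are
[l], [1] and [l + 1], the combination produced by the derivative of [defect].
*)
Lemma contiguous_base u : off_cut u ->
  l%:C * Phi l u + u * Phi (l + 1) u
  + (l + 1)%:C * (1 - u ^+ 2) * Phi (l + 1 + 1) u = 0.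
Proof.
move=> uo; rewrite -[RHS](contiguous_skernel K0 g1 muE mass l uo).
have -> : 2 * (g + 1) - (l + 1) = l by rewrite /l; field.
have -> : 2 * (l - g) = 1 by rewrite /l; field.
by rewrite rmorph1 mul1r.
Qed.

(** [G^l (S Phi_(l+1) - Phi_l)], in which [G^l] is an integrating factor: the
derivative is [G^l / S] times the left-hand side of [contiguous_base]. *)
Definition defect u : R[i] :=
  Cpow (G_W u) l * (G_W_sqrt u * Phi (l + 1) u - Phi l u).

Lemma is_cderive_defect z s : off_cut (z + s%:C) ->
  is_cderive s (fun s => defect (z + s%:C)) 0.
Proof.
move=> zs; have dG := is_cderive_G_W_path zs.
have dC := is_cderive_Cpow l (G_W_slit zs) dG.
have dS := is_cderive_G_W_sqrt_path zs.
have d0 := is_cderive_CintI_skernel mu1 l zs.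
have d1 := is_cderive_CintI_skernel mu1 (l + 1) zs.
apply: (is_cderive_eq (is_cderiveM dC (is_cderiveB (is_cderiveM dS d1) d0))).
have := contiguous_base zs; have := G_W_sqrtE zs.
have := G_W_sqrt_neq0 zs; have := G_W_neq0 zs.
move: (Phi l _) (Phi (l + 1) _) (Phi (l + 1 + 1) _) => p0 p1 p2.
move: (z + s%:C) => u; move: (Cpow _ _) => C.
move: (G_W u) (G_W_sqrt u) => G S G0 S0 SE.
have -> : 1 - u ^+ 2 = - S ^+ 2 by rewrite SE opprB.
have lE : (l + 1)%:C = l%:C + 1 :> R[i] := rmorphD _ l 1.
rewrite lE => H.
transitivity (C / S * (l%:C * p0 + u * p1 + (l%:C + 1) * (- S ^+ 2) * p2)).
  by field; rewrite G0 S0.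
by rewrite H mulr0.
Qed.

(** As [S = u - G / 2], the factor [S - (u - x)] is [x - G / 2], which remains
bounded when [u] tends to infinity although [S] and [u - x] do not. *)
Lemma defectE u : off_cut u -> defect u =
  Cpow (G_W u) l * CintI mu (fun x => (x%:C - G_W u / 2) * skernel u (l + 1) x).
Proof.
move=> uo; rewrite /defect; congr (_ * _).
have ck q := ccont_skernel q uo.
rewrite -[RHS]addr0 -(subrr (Phi l u)) addrA; congr (_ - _).
rewrite -CintIZ// -CintID//; last first.
  apply: ccontM => //; apply: ccontD; last exact: ccont_cst.
  by apply: ccont_real => x; exact: cvg_id.
apply: eq_CintI => x /andP[_ x1]; have su := off_cut_slit uo x1.
rewrite -(skernelM l su) /G_W_sqrt.
have := G_W_inv uo; have := G_W_neq0 uo.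
move: (skernel _ _ _) => k; move: (G_W u) => G G0 ->.
by field.
Qed.

Lemma G_W_mul_sub u x : off_cut u ->
  G_W u * (u - x%:C) = 1 + G_W u * (G_W u / 4 - x%:C).
Proof.
move=> uo; have := G_W_inv uo; have := G_W_neq0 uo.
by move: (G_W u) => G G0 ->; field.
Qed.

Lemma cabs_G_W_mul_sub u x : off_cut u -> cabs (G_W u) <= 1 -> -1 <= x <= 1 ->
  `|cabs (G_W u * (u - x%:C)) - 1| <= 2 * cabs (G_W u).
Proof.
move=> uo G1 xI; rewrite G_W_mul_sub//.
set w := G_W u * (_ - _).
have w1 : cabs w <= 2 * cabs (G_W u).
  rewrite /w cabsM mulrC; apply: ler_wpM2r; first exact: cabs_ge0.
  apply: le_trans (cabsD _ _) _; rewrite cabsN cabs_real cabsM cabsV cabs_nat.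
  have : `|x| <= 1 by rewrite ler_norml.
  lra.
have c1 : cabs (1 : R[i]) = 1 := cabs_nat 1.
apply: le_trans w1; rewrite ler_norml; apply/andP; split.
  have := cabsD (1 + w) (- w); rewrite cabsN addrK c1; lra.
by have := cabsD 1 w; rewrite c1; lra.
Qed.

(** For small [G], [u - x] has modulus between 1/2 and 3/2 times that of
[1 / G], so the integral in [defectE] is [O(|G|^(l + 1))]. *)
Lemma defect_le : exists2 C, 0 <= C & forall u, off_cut u ->
  cabs (G_W u) <= 1 / 4 -> cabs (defect u) <= C * cabs (G_W u) `^ (2 * l + 1).
Proof.
pose C := (1 / 2) `^ (- (l + 1)) + (3 / 2) `^ (- (l + 1)).
have C0 : 0 <= C by rewrite addr_ge0 ?powR_ge0.
exists (2 * C + 2 * C); first by rewrite addr_ge0 ?mulr_ge0.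
move=> u uo Gs; rewrite defectE// cabsM cabs_Cpow ?G_W_neq0//.
have G0 : 0 < cabs (G_W u) by rewrite cabs_gt0 G_W_neq0.
have -> : (2 * C + 2 * C) * cabs (G_W u) `^ (2 * l + 1) =
    cabs (G_W u) `^ l * (2 * (C * cabs (G_W u) `^ (l + 1)) +
    2 * (C * cabs (G_W u) `^ (l + 1))).
  have -> : 2 * l + 1 = l + (l + 1) by ring.
  by rewrite powRD ?(gt_eqF G0) ?implybT//; ring.
apply: ler_wpM2l; first exact: powR_ge0.
apply: (cabs_CintI_le mu1).
  apply: ccontM; last exact: ccont_skernel.
  apply: ccontD; last exact: ccont_cst.
  by apply: ccont_real => x; exact: cvg_id.
move=> x xI; rewrite cabsM; apply: ler_pM; rewrite ?cabs_ge0//.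
  apply: le_trans (cabsD _ _) _; rewrite cabsN cabs_real cabsM cabsV cabs_nat.
  have : `|x| <= 1 by rewrite ler_norml.
  lra.
have G1 : cabs (G_W u) <= 1 by lra.
have /ler_normlP[h1 h2] := cabs_G_W_mul_sub uo G1 xI.
case/andP: xI => _ x1; have su := off_cut_slit uo x1.
have us : cabs (u - x%:C) != 0 by rewrite cabs_eq0 slit_neq0.
rewrite cabs_skernel//.
have -> : cabs (u - x%:C) = cabs (G_W u * (u - x%:C)) * (cabs (G_W u))^-1.
  by rewrite cabsM; field; rewrite gt_eqF.
rewrite powRM ?cabs_ge0 ?invr_ge0//.
rewrite -(powR_inv1 (ltW G0)) -powRrM mulN1r opprK.
apply: ler_wpM2r; first exact: powR_ge0.
apply: powR_le_ends; first lra.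
by apply/andP; split; lra.
exact: cabs_ge0.
Qed.

(** The constant value of [defect] on a half-line is its limit at infinity,
which is 0 since [2 l + 1 = 2 (g + 1) > 0]. *)
Lemma defect0 z : off_cut z -> defect z = 0.
Proof.
move=> zo; have zs s : 0 <= s -> off_cut (z + s%:C) by exact: off_cut_shift.
have dc s : 0 <= s -> defect (z + s%:C) = defect z.
  move=> s0; have dd t : 0 <= t -> is_cderive t (fun s => defect (z + s%:C)) 0.
    by move=> t0; apply: is_cderive_defect; exact: zs.
  by rewrite (is_cderive0_cst dd s0) rmorph0 addr0.
have [C C0 dC] := defect_le.
have q0 : 0 < 2 * l + 1 by rewrite /l; have := g1; lra.
apply/eqP; rewrite -cabs_eq0 eq_le cabs_ge0 andbT leNgt; apply/negP => d0.
pose e := cabs (defect z) / (C + 1).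
have e0 : 0 < e by rewrite divr_gt0// ltr_wpDl.
have [_ /posnumP[d] pd] := cvgr_lt _ (powR_cvg0 q0) e e0.
near (pinfty_nbhs R) => s.
have [s0 Gs] : 0 <= s /\ cabs (G_W (z + s%:C)) < Num.min (1 / 4) d%:num.
  by near: s; apply: G_W_small => //; rewrite lt_min divr_gt0//=.
have so := zs s s0; move: Gs; rewrite lt_min => /andP[G4 Gd].
have G0 : 0 < cabs (G_W (z + s%:C)) by rewrite cabs_gt0 G_W_neq0.
have := dC _ so (ltW G4); rewrite dc//.
have := pd (cabs (G_W (z + s%:C))); rewrite /= sub0r normrN gtr0_norm//.
move=> /(_ Gd G0); rewrite /e ltr_pdivlMr; last by rewrite ltr_wpDl.
have := powR_ge0 (cabs (G_W (z + s%:C))) (2 * l + 1).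
move: (_ `^ _) => r r0 h1 h2; lra.
Unshelve. all: by end_near. Qed.

Lemma Phi_succ z : off_cut z -> G_W_sqrt z * Phi (l + 1) z = Phi l z.
Proof.
move=> zo; have := defect0 zo => /eqP; rewrite mulf_eq0 (negbTE (Cpow_neq0 _ _)) /=.
by rewrite subr_eq0 => /eqP.
Qed.

End base_cases.

(** * Logarithms near infinity *)

Section logarithm_at_infinity.
Context {R : realType}.
Implicit Types (z u w : R[i]) (s x e q : R).

Lemma continuous_ball (f : R -> R) (a e : R) : {for a, continuous f} -> 0 < e ->
  exists2 d, 0 < d & forall x, `|x - a| < d -> `|f x - f a| < e.
Proof.
move=> /cvgrPdist_lt fa /fa[d /= d0 Hd]; exists d => // x xa.
by rewrite distrC; apply: Hd; rewrite /= distrC.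
Qed.

Lemma Cexp_near0 e : 0 < e -> exists2 d, 0 < d &
  forall w, `|complex.Re w| < d -> `|complex.Im w| < d -> cabs (Cexp w - 1) < e.
Proof.
move=> e0; pose h := Num.min (e / 8) 1.
have h0 : 0 < h by rewrite lt_min divr_gt0//=.
have h1 : h <= 1 by rewrite ge_min lexx orbT.
have h8 : h <= e / 8 by rewrite ge_min lexx.
have [d1 d10 Hd1] := continuous_ball (@continuous_expR R 0) h0.
have [d2 d20 Hd2] := continuous_ball (@continuous_cos R 0) h0.
have [d3 d30 Hd3] := continuous_ball (@continuous_sin R 0) h0.
exists (Num.min d1 (Num.min d2 d3)); first by rewrite !lt_min d10 d20.
move=> w; rewrite !lt_min => /and3P[a1 _ _] /and3P[_ b2 b3].
have := Hd1 (complex.Re w); rewrite subr0 => /(_ a1).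
have := Hd2 (complex.Im w); rewrite subr0 => /(_ b2).
have := Hd3 (complex.Im w); rewrite subr0 => /(_ b3).
rewrite expR0 cos0 sin0 subr0 => s3 c2 e1.
apply: le_lt_trans (cabs_le_ReIm _) _; rewrite cReD cImD cReN cImN /= subr0.
move: (expR _) (cos _) (sin _) s3 c2 e1 => E c s.
move=> /ltr_normlP[s1 s2] /ltr_normlP[c1 c2] /ltr_normlP[e1 e2].
have H1 : `|E * c - 1| <= 3 * h by rewrite ler_norml; apply/andP; split; nra.
have H2 : `|E * s| <= 2 * h by rewrite ler_norml; apply/andP; split; nra.
lra.
Qed.

Lemma Carg_small e : 0 < e -> exists2 d, 0 < d &
  forall u, 0 < complex.Re u -> `|complex.Im u| < d * complex.Re u ->
  `|Carg u| < e.
Proof.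
move=> e0; have [d d0 Hd] := continuous_ball (@continuous_atan R 0) e0.
exists d => // u u0 iu; rewrite Carg_Re_gt0//.
have := Hd (complex.Im u / complex.Re u); rewrite atan0 !subr0; apply.
by rewrite normrM normfV (gtr0_norm u0) ltr_pdivrMr.
Qed.

Lemma ln_near1 e : 0 < e -> exists2 d, 0 < d &
  forall x, `|x - 1| < d -> `|ln x| < e.
Proof.
move=> e0; have [d d0 Hd] := continuous_ball (continuous_ln (@ltr01 R)) e0.
by exists d => // x /Hd; rewrite ln1 subr0.
Qed.

Lemma Carg_shift_small z e : 0 < e ->
  \forall s \near +oo, forall x, -1 <= x <= 1 -> `|Carg (z + s%:C - x%:C)| < e.
Proof.
move=> /Carg_small[d d0 Hd]; near=> s.
have sE : 1 - complex.Re z + `|complex.Im z| / d < s.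
  by near: s; apply: nbhs_pinfty_gt; exact: num_real.
have b0 : 0 <= `|complex.Im z| / d by rewrite divr_ge0// ltW.
move=> x /andP[_ x1]; apply: Hd; rewrite !(cReD,cReN,cImD,cImN) /=; first lra.
rewrite oppr0 !addr0 mulrC -ltr_pdivrMr//; lra.
Unshelve. all: by end_near. Qed.

(** Here [G = (1 + G^2 / 4) / u], where [1 + G^2 / 4] tends to 1 and
[u = z + s] has constant imaginary part and large real part. *)
Lemma Carg_G_W_small z e : off_cut z -> 0 < e ->
  \forall s \near +oo, `|Carg (G_W (z + s%:C))| < e.
Proof.
move=> zo /Carg_small[d d0 Hd].
pose r := Num.min (d / 8) (1 / 4).
have r0 : 0 < r by rewrite lt_min !divr_gt0.
have rd : r <= d / 8 by rewrite ge_min lexx.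
have r4 : r <= 1 / 4 by rewrite ge_min lexx orbT.
near=> s; have [s0 Gr] : 0 <= s /\ cabs (G_W (z + s%:C)) < r.
  by near: s; exact: G_W_small.
have sE : 1 - complex.Re z + 8 * `|complex.Im z| + 8 * `|complex.Im z| / d < s.
  by near: s; apply: nbhs_pinfty_gt; exact: num_real.
have b0 : 0 <= `|complex.Im z| / d by rewrite divr_ge0// ltW.
have so := off_cut_shift zo s0.
set G := G_W (z + s%:C) in Gr *.
set u := z + s%:C in so G Gr *.
pose a := complex.Re u; pose b := complex.Im u.
have aE : a = complex.Re z + s by rewrite /a cReD.
have bE : b = complex.Im z by rewrite /b cImD /= addr0.
pose v := G ^+ 2 / 4.
have vr : cabs v <= r.
  rewrite /v expr2 !cabsM cabsV cabs_nat; have := cabs_ge0 G; nra.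
have u0 : u != 0.
  by apply: slit_neq0; have := off_cut_slit so ler01; rewrite rmorph0 subr0.
have n0 : 0 < a ^+ 2 + b ^+ 2.
  by rewrite lt_def addr_ge0 ?sqr_ge0// andbT; exact: sqReIm_neq0.
have GE : G = (1 + v) / u.
  have := G_W_inv so; rewrite -/G => uE.
  apply: (mulIf u0); rewrite divfK// /v {1}uE.
  by field; exact: G_W_neq0.
have Re_v := le_trans (Re_le_cabs v) vr; have Im_v := le_trans (Im_le_cabs v) vr.
have Re1v : complex.Re (1 + v) = 1 + complex.Re v by rewrite cReD.
have Im1v : complex.Im (1 + v) = complex.Im v by rewrite cImD add0r.
have ReG : complex.Re G =
    ((1 + complex.Re v) * a + complex.Im v * b) / (a ^+ 2 + b ^+ 2).
  rewrite GE cReM cReV cImV Re1v Im1v -/a -/b; field.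
  by rewrite gt_eqF.
have ImG : complex.Im G =
    (complex.Im v * a - (1 + complex.Re v) * b) / (a ^+ 2 + b ^+ 2).
  rewrite GE cImM cReV cImV Re1v Im1v -/a -/b; field.
  by rewrite gt_eqF.
have a1 : 1 + 8 * `|b| + 8 * `|b| / d < a by rewrite aE bE; lra.
have bd : 0 <= `|b| / d by rewrite bE.
have b1 : 0 <= `|b| by [].
have aux : 8 * `|b| <= d * a.
  have : d * (8 * `|b| / d) <= d * a by apply: ler_wpM2l; [exact: ltW|lra].
  by rewrite mulrC divfK// gt_eqF.
move: (complex.Re v) (complex.Im v) Re_v Im_v ReG ImG => p q.
move=> /ler_normlP[p1 p2] qr ReG ImG.
have qb : `|q * b| <= r * `|b| by rewrite normrM ler_wpM2r.
have /ler_normlP[qb1 qb2] := qb.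
have pos : a / 2 < (1 + p) * a + q * b by nra.
apply: Hd; rewrite ReG.
  by rewrite divr_gt0//; lra.
rewrite ImG mulrA normrM normfV (gtr0_norm n0) ltr_pM2r ?invr_gt0//.
apply: (@lt_le_trans _ _ (d * (a / 2))); last by rewrite ler_pM2l// ltW.
apply: le_lt_trans (ler_normB _ _) _; rewrite !normrM.
have ha : `|a| = a by rewrite gtr0_norm//; lra.
have hp : `|1 + p| <= 2 by rewrite ler_norml; apply/andP; split; lra.
have h1 : `|q| * `|a| <= d / 8 * a by rewrite ha; apply: ler_wpM2r; lra.
have h2 : `|1 + p| * `|b| <= 2 * `|b| by apply: ler_wpM2r.
have h3 : 0 < d * a by rewrite mulr_gt0//; lra.
lra.
Unshelve. all: by end_near. Qed.

End logarithm_at_infinity.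

(** * The value at order l *)

Section base_value.
Context {R : realType}.
Notation leb := (@lebesgue_measure R).
Variables (mu : {measure set (measurableTypeR R) -> \bar R}) (K g : R).
Hypotheses (K0 : 0 <= K) (g1 : -1 < g).
Hypothesis muE : forall A, measurable A ->
  mu A = (\int[leb]_(x in A) (jacobi_pdf K g x)%:E)%E.
Hypothesis mass : mu setT = 1%E.
Implicit Types (z u : R[i]) (s x q e : R).

Let mu1 := jacobi_itv_mass muE mass.
Notation Phi q u := (CintI mu (skernel u q)).

(** Uniformly in [x], the product [G (u - x)] tends to 1. For principal powers
this does not suffice to make [G^(-q) (u - x)^(-q)] tend to 1, because
[Clog G + Clog (u - x)] could tend to a nonzero multiple of [2 i pi]; the
arguments of [G] and of [u - x] are therefore shown to tend to 0 separately.
*)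
Lemma cabs_normalized_sub1 z q e : off_cut z -> 0 < e -> \forall s \near +oo,
  0 <= s /\ cabs (Cpow (G_W (z + s%:C)) (- q) * Phi q (z + s%:C) - 1) < e.
Proof.
move=> zo e0; have e4 : 0 < e / 4 by rewrite divr_gt0.
have [d d0 Hd] := Cexp_near0 e4.
pose t := d / (2 * (`|q| + 1)).
have q0 : 0 < `|q| + 1 by rewrite ltr_wpDl.
have t0 : 0 < t by rewrite divr_gt0// mulr_gt0.
have tq : `|q| * (2 * t) < d.
  have -> : d = (`|q| + 1) * (2 * t) by rewrite /t; field; rewrite gt_eqF.
  by rewrite ltr_pM2r ?ltrDl// mulr_gt0.
have [m m0 Hm] := ln_near1 t0.
pose r := Num.min (m / 4) 1.
have r0 : 0 < r by rewrite lt_min divr_gt0/=.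
near=> s.
have [s0 Gr] : 0 <= s /\ cabs (G_W (z + s%:C)) < r.
  by near: s; exact: G_W_small.
have argG : `|Carg (G_W (z + s%:C))| < t by near: s; exact: Carg_G_W_small.
have argz : forall x, -1 <= x <= 1 -> `|Carg (z + s%:C - x%:C)| < t.
  by near: s; exact: Carg_shift_small.
split => //; have so := off_cut_shift zo s0.
have {}argz := argz; move: (z + s%:C) so Gr argG argz => u uo Gr argG argz.
have ck := ccont_skernel q uo.
have cC := ccontZ (Cpow (G_W u) (- q)) ck.
have c1 : ccont (fun=> -1 : R[i]) := ccont_cst _.
have -> : Cpow (G_W u) (- q) * Phi q u - 1 =
    CintI mu (fun x => Cpow (G_W u) (- q) * skernel u q x + -1).
  by rewrite CintID// CintIZ// CintI_cst.
apply: (@le_lt_trans _ _ (e / 4 + e / 4)); last lra.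
apply: (cabs_CintI_le mu1).
  exact: ccontD.
move=> x xI; apply: ltW.
have -> : Cpow (G_W u) (- q) * skernel u q x =
    Cexp ((- q)%:C * (Clog (G_W u) + Clog (u - x%:C))).
  by rewrite skernelE /Cpow -CexpD -mulrDr.
have x1 : x <= 1 by case/andP: xI.
have us : cabs (u - x%:C) > 0 by rewrite cabs_gt0 slit_neq0// off_cut_slit.
have G0 : 0 < cabs (G_W u) by rewrite cabs_gt0 G_W_neq0.
have -> : (- q)%:C * (Clog (G_W u) + Clog (u - x%:C)) =
    (- q * (ln (cabs (G_W u)) + ln (cabs (u - x%:C)))) +i*
    (- q * (Carg (G_W u) + Carg (u - x%:C))).
  by apply: complex_ext; rewrite ?cReM ?cImM /= mul0r ?subr0 ?addr0.
apply: Hd; rewrite [X in `|X|]/= normrM normrN;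
  apply: le_lt_trans tq; apply: ler_wpM2l => //.
- rewrite -lnM ?posrE// -cabsM.
  move: Gr; rewrite lt_min => /andP[G4 G1].
  have h : `|cabs (G_W u * (u - x%:C)) - 1| < m.
    by apply: le_lt_trans (cabs_G_W_mul_sub uo (ltW G1) xI) _; lra.
  by have := Hm _ h; lra.
- by have := argz x xI; have := ler_normD (Carg (G_W u)) (Carg (u - x%:C)); lra.
Unshelve. all: by end_near. Qed.

(** By [Phi_succ] the derivative of [Phi_l] is [- l Phi_l / S], and the one of
[G^l] is [- l G^l / S]. Hence the quotient is constant, equal to its limit 1
at infinity. *)
Lemma Phi_base z : off_cut z -> Phi (g + 1 / 2) z = Cpow (G_W z) (g + 1 / 2).
Proof.
set l := g + 1 / 2 => zo.
pose H s := Cpow (G_W (z + s%:C)) (- l) * Phi l (z + s%:C).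
have dH s : 0 <= s -> is_cderive s H 0.
  move=> s0; have so := off_cut_shift zo s0.
  have dG := is_cderive_G_W_path so.
  have dC := is_cderive_Cpow (- l) (G_W_slit so) dG.
  have dP := is_cderive_CintI_skernel mu1 l so.
  apply: (is_cderive_eq (is_cderiveM dC dP)).
  rewrite -(Phi_succ K0 g1 muE mass so) -/l rmorphN /=.
  have := G_W_sqrt_neq0 so; have := G_W_neq0 so.
  move: (Phi _ _) => p; move: (Cpow _ _) => C.
  move: (z + s%:C) => u; move: (G_W u) (G_W_sqrt u) => G S G0 S0.
  by field; rewrite G0 S0.
have H1 : H 0 = 1.
  apply/eqP; rewrite -subr_eq0 -cabs_eq0 eq_le cabs_ge0 andbT.
  apply/ler_addgt0Pl => e e0; rewrite addr0.
  near (pinfty_nbhs R) => s.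
  have [s0 Hs] : 0 <= s /\ cabs (H s - 1) < e.
    by near: s; exact: cabs_normalized_sub1.
  by rewrite -(is_cderive0_cst dH s0) ltW.
move: H1; rewrite /H rmorph0 addr0 CpowN => h.
by rewrite -[RHS]mulr1 -h mulVKf// Cpow_neq0.
Unshelve. all: by end_near. Qed.

End base_value.

(** * Terminating hypergeometric sums *)

Section terminating_hypergeometric.
Context {R : realType}.
Implicit Types (a b c u v K : R[i]) (n m N k j : nat).

Lemma pochhammer0 a : pochhammer a 0 = 1.
Proof. by rewrite /pochhammer big_geq. Qed.

Lemma pochhammerS a n : pochhammer a n.+1 = pochhammer a n * (a + n%:R).
Proof. by rewrite /pochhammer big_nat_recr. Qed.

Lemma pochhammerSl a n : pochhammer a n.+1 = a * pochhammer (a + 1) n.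
Proof.
rewrite /pochhammer big_nat_recl//= addr0; congr (_ * _).
by apply: eq_bigr => i _; rewrite -addrA nat1r.
Qed.

Lemma pochhammer_shift a n : a * pochhammer (a + 1) n = pochhammer a n * (a + n%:R).
Proof. by rewrite -pochhammerSl pochhammerS. Qed.

Lemma pochhammer_nat_eq0 k n : (k < n)%N -> pochhammer (- k%:R : R[i]) n = 0.
Proof.
move=> kn; rewrite /pochhammer (bigD1_seq k) /=.
- by rewrite addNr mul0r.
- by rewrite mem_index_iota.
- exact: iota_uniq.
Qed.

Definition hyp_term a b c u n : R[i] :=
  pochhammer a n * pochhammer b n / pochhammer c n * (u ^+ n / n`!%:R).

(** The parameter [K] is a ring element rather than an integer and the range
is fixed independently of it, so that the recurrence in [K] can be proved term
by term. *)
Definition hyp_sum N K c u : R[i] :=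
  \sum_(0 <= n < N) hyp_term K (1 - K) c u n.

Lemma hyp_sum_stable N k c u : (k < N)%N ->
  hyp_sum N k%:R c u = hyp_sum k.+1 k%:R c u.
Proof.
move=> kN; rewrite /hyp_sum (big_cat_nat _ (n := k.+1))//= [X in _ + X]big_nat_cond.
rewrite [X in _ + X]big1 ?addr0// => n /andP[/andP[kn _] _].
(* For k = 0 the factor (k)_n vanishes from n = 1 on; for k > 0 it is (1 -
   k)_n that vanishes, from n = k on. *)
rewrite /hyp_term; case: k kN kn => [|k] kN kn.
  by have := pochhammer_nat_eq0 kn; rewrite oppr0 => ->; rewrite !mul0r.
rewrite -natr1 opprD addrCA subrr addr0 pochhammer_nat_eq0 ?mulr0 ?mul0r//.
exact: ltnW.
Qed.

Lemma hyp2F1_hyp_sum N k c u : (k < N)%N ->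
  hyp2F1 k%:R (1 - k%:R) c u = hyp_sum N k%:R c u.
Proof.
move=> kN; pose f : nat -> (R[i])^o := hyp_term k%:R (1 - k%:R) c u.
have H : \forall n \near \oo, series f n = hyp_sum N k%:R c u.
  near=> n; rewrite (hyp_sum_stable _ _ kN) -(hyp_sum_stable (N := n))//.
  by near: n; exists k.+1.
exact: (@lim_near_cst (R[i])^o (@norm_hausdorff _ (R[i])^o) _ _ _ _ _ H).
Unshelve. all: by end_near. Qed.

(** The recurrence holds for each power of [u]: after
[(K)_n (1 - K)_n u^(n+1) / ((c)_n n!)] is factored out, it is an identity
between rational functions of [K], [c], [n]. *)
Lemma hyp_term_rec K c u n : K != 0 -> (forall m, c + m%:R != 0) ->
  (c + K - 1) * hyp_term (K + 1) (1 - (K + 1)) c u n.+1 =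
  (2 * K - 1) * (hyp_term K (1 - K) c u n.+1 - 2 * u * hyp_term K (1 - K) c u n)
  + (c - K) * hyp_term (K - 1) (1 - (K - 1)) c u n.+1.
Proof.
move=> K0 c0.
have pc m : pochhammer c m != 0.
  by elim: m => [|m IH]; rewrite ?pochhammer0 ?oner_eq0// pochhammerS mulf_neq0.
have f0 m : m`!%:R != 0 :> R[i] by rewrite pnatr_eq0 -lt0n fact_gt0.
have n0 : n.+1%:R != 0 :> R[i] by rewrite pnatr_eq0.
have e1 : pochhammer (K + 1) n.+1 * pochhammer (1 - (K + 1)) n.+1 =
    - (K + n%:R) * (K + n%:R + 1) * (pochhammer K n * pochhammer (1 - K) n).
  rewrite pochhammerS pochhammerSl.
  have -> : 1 - (K + 1) + 1 = 1 - K by ring.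
  have := pochhammer_shift K n.
  move: (pochhammer (K + 1) n) (pochhammer K n) (pochhammer (1 - K) n) => p q r H.
  transitivity (- (K * p) * (K + n%:R + 1) * r); first by ring.
  by rewrite H; ring.
have e2 : pochhammer K n.+1 * pochhammer (1 - K) n.+1 =
    (K + n%:R) * (n%:R + 1 - K) * (pochhammer K n * pochhammer (1 - K) n).
  by rewrite !pochhammerS; ring.
have e3 : pochhammer (K - 1) n.+1 * pochhammer (1 - (K - 1)) n.+1 =
    - (n%:R + 1 - K) * (n%:R + 2 - K) * (pochhammer K n * pochhammer (1 - K) n).
  rewrite pochhammerSl pochhammerS subrK.
  have -> : 1 - (K - 1) = 1 - K + 1 by ring.
  have := pochhammer_shift (1 - K) n.
  move: (pochhammer (1 - K + 1) n) (pochhammer K n) (pochhammer (1 - K) n) => p q r H.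
  transitivity (- q * ((1 - K) * p) * (1 - K + 1 + n%:R)); first by ring.
  by rewrite H; ring.
rewrite /hyp_term e1 e2 e3 pochhammerS factS natrM exprS.
have := pc n; have := c0 n; have := f0 n; move: n0; rewrite -natr1.
move: (pochhammer K n) (pochhammer (1 - K) n) (pochhammer c n) => A B C.
move: (n`!%:R) (u ^+ n) (n%:R) => F U n' h1 h2 h3 h4.
by field; rewrite h1 h2 h3 h4.
Qed.

Lemma hyp_sum_rec N K c u : K != 0 -> (forall m, c + m%:R != 0) ->
  (c + K - 1) * hyp_sum N.+1 (K + 1) c u =
  (2 * K - 1) * (hyp_sum N.+1 K c u - 2 * u * hyp_sum N K c u)
  + (c - K) * hyp_sum N.+1 (K - 1) c u.
Proof.
move=> K0 c0.
have S (a b : R[i]) : \sum_(0 <= n < N.+1) hyp_term a b c u n =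
    1 + \sum_(0 <= n < N) hyp_term a b c u n.+1.
  rewrite big_nat_recl//; congr (_ + _).
  by rewrite /hyp_term !pochhammer0 fact0 expr0 mulr1 !divr1 mulr1.
rewrite /hyp_sum !S.
rewrite mulrDr mulr_sumr.
under eq_bigr => n _ do rewrite (hyp_term_rec u n K0 c0).
rewrite big_split /= -!mulr_sumr sumrB -mulr_sumr.
ring.
Qed.

End terminating_hypergeometric.

(** * All orders *)

Section all_orders.
Context {R : realType}.
Notation leb := (@lebesgue_measure R).
Variables (mu : {measure set (measurableTypeR R) -> \bar R}) (K g : R).
Hypotheses (K0 : 0 <= K) (g1 : -1 < g).
Hypothesis muE : forall A, measurable A ->
  mu A = (\int[leb]_(x in A) (jacobi_pdf K g x)%:E)%E.
Hypothesis mass : mu setT = 1%E.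
Variable z : R[i].
Hypothesis zo : off_cut z.

Let G := G_W z.
Let S := G_W_sqrt z.
Let v := G ^+ 2 / (G ^+ 2 - 4).
Let c : R[i] := (g + 3 / 2)%:C.
Let l := g + 1 / 2.
(** The factor [S^n] absorbs the powers of [z^2 - 1 = S^2] in the contiguous
relation, after which [z] occurs in its coefficients only as [z / S]. *)
Let Psi n := S ^+ n * CintI mu (skernel z (l + n%:R)).
Let hyp n := hyp2F1 n%:R (1 - n%:R) c v.

Let G0 : G != 0. Proof. exact: G_W_neq0. Qed.
Let S0 : S != 0. Proof. exact: G_W_sqrt_neq0. Qed.

Let S_G : S = (4 - G ^+ 2) / (4 * G).
Proof. by rewrite /S /G_W_sqrt -/G; field; exact: G0. Qed.

Lemma G_W_sqr_neq4 : 4 - G ^+ 2 != 0.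
Proof. by apply: contraNneq S0 => h; rewrite S_G h mul0r. Qed.

(** The contiguous relation at order [l + n], as [1 - 2 v = z / S]. *)
Lemma Psi_rec n : (c + n%:R) * Psi n.+2 =
  (2 * n%:R + 1) * (1 - 2 * v) * Psi n.+1 + (c - n%:R - 1) * Psi n.
Proof.
have := contiguous_skernel K0 g1 muE mass (l + n%:R) zo.
have -> : l + n%:R + 1 = l + n.+1%:R by rewrite -[n.+1%:R]natr1 addrA.
have -> : l + n.+1%:R + 1 = l + n.+2%:R by rewrite -[n.+2%:R]natr1 addrA.
have -> : (2 * (g + 1) - (l + n.+1%:R))%:C = c - n%:R - 1.
  rewrite /c -(rmorph_nat (real_complex R)) -[X in _ = _ - X](rmorph1 (real_complex R)).
  by rewrite -!rmorphB; congr (_%:C); rewrite /l -[n.+1%:R]natr1; field.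
have -> : (2 * (l + n%:R - g))%:C = 2 * n%:R + 1.
  rewrite -(rmorph_nat (real_complex R) 2) -(rmorph_nat (real_complex R) n).
  rewrite -[X in _ = _ + X](rmorph1 (real_complex R)) -rmorphM -rmorphD.
  by congr (_%:C); rewrite /l; field.
have -> : (l + n.+1%:R)%:C = c + n%:R.
  rewrite /c -(rmorph_nat (real_complex R)) -rmorphD.
  by congr (_%:C); rewrite /l -[n.+1%:R]natr1; field.
have SE : 1 - z ^+ 2 = - S ^+ 2 by rewrite /S (G_W_sqrtE zo) opprB.
rewrite SE /Psi (exprS S n.+1) (exprS S n).
have vE : 1 - 2 * v = z / S.
  rewrite (G_W_inv zo) S_G /v -/G; have := G_W_sqr_neq4; have := G0.
  move: G => u u0 u4; have u4' : u ^+ 2 - 4 != 0 by rewrite -opprB oppr_eq0.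
  by field; rewrite u0 u4 u4'.
rewrite vE; have := S0.
move: (CintI _ _) (CintI _ _) (CintI _ _) => p0 p1 p2.
move: (S ^+ n) => T; move: (n%:R) => m; move: S => u u0 H.
apply/eqP; rewrite -subr_eq0; apply/eqP.
rewrite -[RHS](mulr0 (- T)) -[X in _ = _ * X]H.
by field.
Qed.

Let c_neq0 m : c + m%:R != 0.
Proof.
rewrite /c -(rmorph_nat (real_complex R)) -rmorphD /=.
rewrite eq_complex /= negb_and; apply/orP; left; rewrite gt_eqF//.
by have := g1; have := ler0n R m; lra.
Qed.

Lemma hyp_rec n : (c + n%:R) * hyp n.+2 =
  (2 * n%:R + 1) * (1 - 2 * v) * hyp n.+1 + (c - n%:R - 1) * hyp n.
Proof.
have K1 : n.+1%:R != 0 :> R[i] by rewrite pnatr_eq0.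
(* With n + 3 terms or more, all sums involved contain the complete series. *)
have := hyp_sum_rec n.+3 v K1 c_neq0.
have e : n.+1%:R - 1 = n%:R :> R[i] by rewrite -[n.+1%:R]natr1 addrK.
rewrite natr1 e.
rewrite -(hyp2F1_hyp_sum c v (leq_addl 1 n.+3)).
rewrite -(hyp2F1_hyp_sum c v (leq_addl 2 n.+2)).
rewrite -(hyp2F1_hyp_sum c v (leq_addl 1 n.+2)).
rewrite -(hyp2F1_hyp_sum c v (leq_addl 3 n.+1)).
rewrite -/(hyp n.+2) -/(hyp n.+1) -/(hyp n) => H.
have -> : c + n%:R = c + n.+1%:R - 1 by rewrite -[n.+1%:R]natr1; ring.
rewrite H -[n.+1%:R]natr1; ring.
Qed.

(** Both sides satisfy the same recurrence, whose leading coefficient [c + n]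
does not vanish. They agree for [n = 0] by [Phi_base] and for [n = 1] by
[Phi_succ], the series being equal to 1 in these two cases. *)
Lemma Psi_hyp n : Psi n = Cpow G l * hyp n.
Proof.
have hyp0 : hyp 0 = 1.
  rewrite /hyp (@hyp2F1_hyp_sum R 1)// /hyp_sum big_nat1 /hyp_term.
  by rewrite !pochhammer0 fact0 expr0 mulr1 !divr1 mulr1.
have hyp1 : hyp 1 = 1.
  rewrite /hyp (@hyp2F1_hyp_sum R 2)// /hyp_sum big_nat_recl// big_nat1 /hyp_term.
  rewrite !pochhammer0 fact0 expr0 !pochhammerS !pochhammer0 subrr addr0.
  by rewrite add0r !mulr0 !mul0r addr0 mulr1 !divr1 mulr1.
suff [] : Psi n = Cpow G l * hyp n /\ Psi n.+1 = Cpow G l * hyp n.+1 by [].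
elim: n => [|n [IH0 IH1]]; split => //.
- by rewrite /Psi expr0 mul1r addr0 hyp0 mulr1 (Phi_base K0 g1 muE mass zo).
- rewrite /Psi expr1 hyp1 mulr1 (Phi_succ K0 g1 muE mass zo).
  by rewrite (Phi_base K0 g1 muE mass zo).
- apply: (mulfI (c_neq0 n)); rewrite Psi_rec IH0 IH1 [RHS]mulrCA hyp_rec; ring.
Qed.

Lemma CintI_skernel_hyp n : CintI mu (skernel z (l + n%:R)) =
  4 ^+ n * Cpow G (l + n%:R) / (4 - G ^+ 2) ^+ n * hyp n.
Proof.
apply: (mulfI (expf_neq0 n S0)); rewrite -/(Psi n) Psi_hyp.
rewrite (CpowDn _ _ (G_W_slit zo)) S_G expr_div_n exprMn.
have := expf_neq0 n G0; have := expf_neq0 n G_W_sqr_neq4.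
have : (4 : R[i]) ^+ n != 0 by rewrite expf_neq0// pnatr_eq0.
rewrite -/G; move: (4 ^+ n) ((4 - G ^+ 2) ^+ n) (G ^+ n) => a b d a0 b0 d0.
by field; rewrite a0 b0 d0.
Qed.

End all_orders.

Theorem proposition3p1 (R : realType) (gamma : R) (k : nat)
  (hgamma : -1 < gamma) (hlambda : 0 <= gamma + 1 / 2 + k%:R)
  (z : R[i]) (hz : ~ (complex.Im z = 0 /\ complex.Re z <= 1)) :
  let lambda := gamma + 1 / 2 + k%:R in
  gen_stieltjes lambda (ultraspherical gamma) z =
    4 ^+ k * Cpow (G_W z) lambda / (4 - G_W z ^+ 2) ^+ k
    * hyp2F1 k%:R (1 - k%:R) (gamma + 3 / 2)%:C
        (G_W z ^+ 2 / (G_W z ^+ 2 - 4)).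
Proof.
have zo : off_cut z.
  rewrite /off_cut; case: eqVneq => //= z0.
  by rewrite ltNge; apply/negP => z1; apply: hz.
have K0 : 0 <= Gamma (gamma + 3 / 2) / (Num.sqrt pi * Gamma (gamma + 1)).
  by apply: divr_ge0; [|apply: mulr_ge0]; rewrite ?sqrtr_ge0 ?Gamma_ge0.
have muE A : measurable A -> ultraspherical gamma A =
    (\int[lebesgue_measure]_(x in A) (jacobi_pdf
      (Gamma (gamma + 3 / 2) / (Num.sqrt pi * Gamma (gamma + 1))) gamma x)%:E)%E.
  by move=> mA; rewrite -ultraspherical_pdfE.
rewrite /= (gen_stieltjes_CintI K0 muE).
exact: (CintI_skernel_hyp K0 hgamma muE (ultraspherical_mass hgamma) zo).
Qed.
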